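(* Let $G$ be a finitely generated group with at least stretched exponential growth, and let $A$ be a finite alphabet with $|A|\ge 2$. Then $\mathrm{Aut}(A^G)$ has a finitely generated subgroup that does not embed into $\mathrm{Aut}(B^{\mathbb{Z}^d})$ for any finite alphabet $B$ and any $d\in\mathbb{N}$.
   Context: For a finite set $A$ and a countable group $G$, $A^G$ has the product topology and the continuous $G$-action $(gx)_h=x_{g^{-1}h}$; $\mathrm{Aut}(A^G)$ is the group (under composition) of $G$-equivariant homeomorphisms $A^G\to A^G$. $G$ has at least stretched exponential growth if for some (equivalently any) finite generating set there is $\beta>0$ such that the ball $B_k$ of radius $k$ in the word metric satisfies $|B_k|=\Omega(e^{k^\beta})$. ''Embeds'' means as an abstract group, via an injective homomorphism. *)

(* Defs.v *)
From HB Require Import structures.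
From mathcomp Require Import all_boot all_order all_algebra.
From mathcomp Require Import finmap.
From mathcomp Require Import all_classical all_reals all_analysis.

Set Implicit Arguments.
Unset Strict Implicit.
Unset Printing Implicit Defensive.

Import Order.TTheory GRing.Theory Num.Theory.
Import numFieldNormedType.Exports.

Local Open Scope classical_set_scope.
Local Open Scope group_scope.

Definition is_subgroup (G : groupType) (H : set G) : Prop :=
  H 1 /\ forall x y : G, H x -> H y -> H (x / y).

Definition generated (G : groupType) (S : set G) : set G :=
  smallest (@is_subgroup G) S.

Definition fin_gen (G : groupType) (H : set G) : Prop :=
  exists2 S : set G, finite_set S & generated S = H.

Lemma is_subgroup_generated (G : groupType) (S : set G) : is_subgroup (generated S).
Proof.
split=> [M [[M1 _] _] //|x y Sx Sy M MS].
by have [[_ Mdiv] _] := MS; apply: Mdiv; [exact: Sx | exact: Sy].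
Qed.

(* A homomorphism H -> K is represented by a total map of which only the
   restriction to H matters. *)
Definition embeds (G : groupType) (H : set G) (K : groupType) : Prop :=
  exists f : G -> K,
    {in H &, {morph f : x y / x * y}} /\ {in H &, injective f}.

Definition word_ball (G : groupType) (S : set G) (k : nat) : set G :=
  [set g | exists w : seq G, [/\ (size w <= k)%N,
     forall s, s \in w -> S s \/ S s^-1 & g = \prod_(s <- w) s]].

(* So the junk value of fset_set on infinite sets is never reached in
   stretched_exp_growth. *)
Lemma finite_word_ball (G : groupType) (S : set G) (k : nat) :
  finite_set S -> finite_set (word_ball S k).
Proof.
move=> finS; pose T := S `|` (fun x : G => x^-1) @` S.
have finT : finite_set T.
  by rewrite finite_setU; split=> //; exact: finite_image.
elim: k => [|k IHk].
  apply: (@sub_finite_set _ _ [set 1]) => // g [w [+ _ ->]].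
  by rewrite leqn0 size_eq0 => /eqP ->; rewrite big_nil.
apply: (@sub_finite_set _ _ (1 |` [set x * y | x in T & y in word_ball S k])).
  move=> g [[|s w] [/= szw Sw ->]]; first by left; rewrite big_nil.
  right; exists s; first last.
    exists (\prod_(i <- w) i); last by rewrite big_cons.
    by exists w; split=> // i iw; apply: Sw; rewrite inE iw orbT.
  have [Ss|Ss] := Sw s (mem_head _ _); [by left|right].
  by exists s^-1 => //; rewrite invgK.
by rewrite finite_setU; split=> //; exact: finite_image2.
Qed.

Definition stretched_exp_growth (R : realType) (G : groupType) : Prop :=
  exists S : set G, [/\ finite_set S, generated S = [set: G] &
    exists2 beta : R, (0 < beta)%R &
      (fun k : nat => (#|` fset_set (word_ball S k)|%:R : R^o)%R)
        \is 'Omega_\oo (fun k : nat => expR (k%:R `^ beta)%R : R^o)].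

Definition config (G : groupType) (A : finType) : Type :=
  prod_topology (fun _ : G => discrete_topology A).

HB.instance Definition _ (G : groupType) (A : finType) :=
  Topological.on (config G A).

Definition homeomorphism (X Y : topologicalType) (f : X -> Y) : Prop :=
  exists h : Y -> X,
    [/\ cancel f h, cancel h f, continuous f & continuous h].

Section ShiftAut.
Context (G : groupType) (A : finType).
Local Notation X := (config G A).

Definition translate (g : G) (x : X) : X := fun h => x (g^-1 * h).

Definition equivariant (f : X -> X) : Prop :=
  forall g x, f (translate g x) = translate g (f x).

Record shift_aut := ShiftAut {
  aut_fun :> X -> X;
  aut_funP : `[< homeomorphism aut_fun /\ equivariant aut_fun >] }.

HB.instance Definition _ := [isSub for aut_fun].
HB.instance Definition _ := [Choice of shift_aut by <:].

Lemma shift_autP (f : shift_aut) : homeomorphism f /\ equivariant f.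
Proof. exact/asboolP/aut_funP. Qed.

Definition aut_inv_fun (f : shift_aut) : X -> X :=
  projT1 (cid (shift_autP f).1).

Lemma aut_inv_funP (f : shift_aut) :
  [/\ cancel f (aut_inv_fun f), cancel (aut_inv_fun f) f,
      continuous f & continuous (aut_inv_fun f)].
Proof. exact: projT2 (cid (shift_autP f).1). Qed.

Lemma aut_one_subproof : `[< @homeomorphism X X id /\ equivariant id >].
Proof.
by apply/asboolP; split=> //; exists id; split=> // x; exact: cvg_id.
Qed.

Lemma aut_mul_subproof (f g : shift_aut) :
  `[< homeomorphism (f \o g) /\ equivariant (f \o g) >].
Proof.
have [fK fVK cf cfV] := aut_inv_funP f.
have [gK gVK cg cgV] := aut_inv_funP g.
apply/asboolP; split; last first.
  by move=> a x /=; rewrite (shift_autP g).2 (shift_autP f).2.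
exists (aut_inv_fun g \o aut_inv_fun f); split.
- exact: can_comp.
- exact: can_comp.
- by move=> x; apply: continuous_comp; [exact: cg | exact: cf].
- by move=> x; apply: continuous_comp; [exact: cfV | exact: cgV].
Qed.

Lemma aut_inv_subproof (f : shift_aut) :
  `[< homeomorphism (aut_inv_fun f) /\ equivariant (aut_inv_fun f) >].
Proof.
have [fK fVK cf cfV] := aut_inv_funP f.
apply/asboolP; split; first by exists f.
by move=> a x; rewrite -[in LHS](fVK x) -(shift_autP f).2 fK.
Qed.

Definition aut_one : shift_aut := ShiftAut aut_one_subproof.
Definition aut_mul (f g : shift_aut) : shift_aut :=
  ShiftAut (aut_mul_subproof f g).
Definition aut_inv (f : shift_aut) : shift_aut := ShiftAut (aut_inv_subproof f).

Lemma aut_mulA : associative aut_mul.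
Proof. by move=> f g h; apply: val_inj. Qed.
Lemma aut_1L : left_id aut_one aut_mul.
Proof. by move=> f; apply: val_inj. Qed.
Lemma aut_1R : right_id aut_one aut_mul.
Proof. by move=> f; apply: val_inj. Qed.
Lemma aut_VL : left_inverse aut_one aut_inv aut_mul.
Proof.
by move=> f; apply: val_inj; apply/funext => x /=; have [fK] := aut_inv_funP f.
Qed.
Lemma aut_VR : right_inverse aut_one aut_inv aut_mul.
Proof.
by move=> f; apply: val_inj; apply/funext => x /=; have [_ fVK] := aut_inv_funP f.
Qed.

HB.instance Definition _ := isGroup.Build shift_aut
  aut_mulA aut_1L aut_1R aut_VL aut_VR.

End ShiftAut.

Definition Zpow (d : nat) : groupType := Algebra.to_multiplicative 'rV[int]_d.

(* Main.v *)
From HB Require Import structures.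
Require Import Defs.
From mathcomp Require Import all_boot all_order all_algebra.
From mathcomp Require Import finmap.
From mathcomp Require Import all_classical all_reals all_analysis.
From mathcomp Require Import zify lra.

(* Idea. In [Aut(B^{Z^d})] a nontrivial product of [L] generators of radius [r]
   moves a configuration of period [p = 2 r L + 1], hence acts nontrivially on a
   set of [|B|^(p^d)] points. On the other hand, if [z] is a central involution
   and the commuting involutions [a_i], [b_i], [i < M], satisfy
   [a_i b_i = b_i a_i z] and otherwise commute, then every finite set on which
   they act with [z <> 1] has at least [2^M] points. So it is enough to find, in
   one finitely generated subgroup of [Aut(A^G)], such families with [M] doubly
   exponential in [J] and a nontrivial [z] of word length exponential in [J].

   A "head" is a marker pattern with room for six data bits ("tracks") and for
   static pointers to other heads; two heads never overlap, so the tracks may be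
   flipped freely. The pointers draw binary trees, with subdivided edges, whose
   nodes are heads. Two tracks run the second-order rule
   [chi_{k+2}(u) = chi_k(u) + 1 + chi_{k+1}(left u) * chi_{k+1}(right u)].
   If the root reads [1] at all times [k < 2^(J+1)], then the rule forces the
   children to exist and to read [1] at all inner times, and inductively the
   complete binary tree of depth [2^J - 1] exists below the root: this condition
   at a single cell, of polynomial word length by commutators of conditional
   flips, controls exponentially many cells. Then [z] flips a bit of the root
   under this condition, [a_w] flips the bit stored at the leaf [w], and [b_w]
   flips the bit of the root if moreover the leaf [w] stores a [1].

   The condition is satisfiable because a ball of [G] of radius polynomial in
   [m] has at least [2^(m^2)] elements, whereas a tree of that height and of
   bounded degree which contains no subdivided binary tree of depth [m] has at
   most [2^(O(m log m))] nodes. *)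

Set Implicit Arguments.
Unset Strict Implicit.
Unset Printing Implicit Defensive.

Import Order.TTheory GRing.Theory Num.Theory.
Import numFieldNormedType.Exports.

(** * Heisenberg families of involutions *)

(** For a finite nonempty [I] these relations present an extraspecial 2-group: a central product of
    dihedral groups of order 8, one for each index, whose common centre is generated by [z]. *)
Record heisenberg_rel (I : eqType) (T : Type) (z : T -> T) (a b : I -> T -> T) :
    Prop := HeisenbergRel {
  heis_zz : forall t, z (z t) = t;
  heis_aa : forall i t, a i (a i t) = t;
  heis_bb : forall i t, b i (b i t) = t;
  heis_az : forall i t, a i (z t) = z (a i t);
  heis_bz : forall i t, b i (z t) = z (b i t);
  heis_aC : forall i j t, a i (a j t) = a j (a i t);
  heis_bC : forall i j t, b i (b j t) = b j (b i t);
  heis_abC : forall i j t, i != j -> a i (b j t) = b j (a i t);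
  heis_ab : forall i t, a i (b i t) = b i (a i (z t)) }.

(** Serves to pass to the orbits of one of the involutions, which are points of [{set T}]. *)
Lemma heisenberg_rel_imset (I : eqType) (T : finType) z (a b : I -> T -> T) :
  heisenberg_rel z a b ->
  heisenberg_rel (fun X : {set T} => z @: X) (fun i X => a i @: X)
    (fun i X => b i @: X).
Proof.
case=> zz aa bb az bz aC bC abC ab.
have idE (f : T -> T) (X : {set T}) : (forall t, f t = t) -> f @: X = X.
  by move=> fE; rewrite -[RHS]imset_id; apply: eq_imset.
split=> [X|i X|i X|i X|i X|i j X|i j X|i j X ij|i X]; rewrite -!imset_comp.
- exact: idE.
- by apply: idE; apply: aa.
- by apply: idE; apply: bb.
- by apply: eq_imset; apply: az.
- by apply: eq_imset; apply: bz.
- by apply: eq_imset; apply: aC.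
- by apply: eq_imset; apply: bC.
- by apply: eq_imset => t; apply: abC.
- by apply: eq_imset; apply: ab.
Qed.

Lemma leq_card_fibers2 (T U : finType) (f : T -> U) (g : T -> T) (D : {set T}) :
    {in D, forall t, [/\ g t \in D, g t != t & f (g t) = f t]} ->
  2 * #|f @: D| <= #|D|.
Proof.
move=> gP; rewrite -[#|D|]sum1_card (partition_big_imset f) /=.
rewrite mulnC -sum_nat_const; apply: leq_sum => _ /imsetP[t tD ->].
have [gD gt fg] := gP t tD.
rewrite (bigD1 t) /=; last by rewrite tD eqxx.
by rewrite (bigD1 (g t)) //= gD fg eqxx gt.
Qed.

(** Induction on [s]. If [a i] sends some [t] in [D] to [t] or [z t], then the points with
    [a i t = t] and those with [a i t = z t] form two disjoint nonempty sets, which [b i] exchanges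
    and the other generators preserve. Otherwise there are at most half as many orbits [{t, a i t}]
    as points of [D], and [z] still moves each of them. *)
Lemma heisenberg_card (I : eqType) (s : seq I) (T : finType) (z : T -> T)
    (a b : I -> T -> T) (D : {set T}) :
    uniq s -> heisenberg_rel z a b -> 0 < #|D| ->
    {in D, forall t, z t \in D /\ z t != t} ->
    {in s & D, forall i t, a i t \in D /\ b i t \in D} ->
  2 ^ size s <= #|D|.
Proof.
elim: s T z a b D => [|i s IH] T z a b D; first by [].
move=> /= /andP[iNs us] hR D0 zD abD.
have neq j : j \in s -> i != j by move=> js; apply: contraNneq iNs => ->.
have [/existsP[t0 /andP[t0D at0]]|] :=
  boolP [exists t, (t \in D) && ((a i t == t) || (a i t == z t))].
  pose Dp := [set t in D | a i t == t]; pose Dm := [set t in D | a i t == z t].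
  have iD t : t \in D -> a i t \in D /\ b i t \in D.
    by move=> tD; apply: abD; rewrite ?inE ?eqxx.
  have bpm t : t \in Dp -> b i t \in Dm.
    rewrite !inE => /andP[tD /eqP at_]; rewrite (iD _ tD).2 /=.
    by rewrite (heis_ab hR) (heis_az hR) at_ (heis_bz hR).
  have bmp t : t \in Dm -> b i t \in Dp.
    rewrite !inE => /andP[tD /eqP at_]; rewrite (iD _ tD).2 /=.
    by rewrite (heis_ab hR) (heis_az hR) at_ (heis_zz hR).
  have Dp0 : 0 < #|Dp|.
    apply/card_gt0P; case/orP: at0 => at0; first by exists t0; rewrite inE t0D.
    by exists (b i t0); apply: bmp; rewrite inE t0D.
  have Dm0 : 0 < #|Dm|.
    by have /card_gt0P[t /bpm tm] := Dp0; apply/card_gt0P; exists (b i t).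
  have cp : 2 ^ size s <= #|Dp|.
    apply: (IH _ z a b) => //.
      move=> t; rewrite !inE => /andP[tD /eqP at_]; have [zt ztt] := zD _ tD.
      by rewrite zt ztt (heis_az hR) at_ eqxx.
    move=> j t js; rewrite !inE => /andP[tD /eqP at_].
    have [|ajD bjD] := abD j t _ tD; first by rewrite inE js orbT.
    rewrite ajD bjD /= (heis_aC hR) at_ eqxx.
    by rewrite (heis_abC hR) ?neq // at_ eqxx.
  have cm : 2 ^ size s <= #|Dm|.
    apply: (IH _ z a b) => //.
      move=> t; rewrite !inE => /andP[tD /eqP at_]; have [zt ztt] := zD _ tD.
      by rewrite zt ztt (heis_az hR) at_ eqxx.
    move=> j t js; rewrite !inE => /andP[tD /eqP at_].
    have [|ajD bjD] := abD j t _ tD; first by rewrite inE js orbT.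
    rewrite ajD bjD /= (heis_aC hR) at_ (heis_az hR) eqxx.
    by rewrite (heis_abC hR) ?neq // at_ (heis_bz hR) eqxx.
  have dj : #|Dp :&: Dm| = 0.
    apply: eq_card0 => t; rewrite !inE; apply/negP => /andP[/andP[tD /eqP at_]].
    by rewrite at_ tD eq_sym (negPf (zD t tD).2).
  have sU : Dp :|: Dm \subset D.
    by apply/fintype.subsetP => t; rewrite !inE => /orP[]/andP[].
  rewrite expnS mul2n -addnn; apply: leq_trans (subset_leq_card sU).
  by rewrite cardsU dj subn0 leq_add.
rewrite negb_exists => /forallP hfree.
have afree t : t \in D -> a i t != t /\ a i t != z t.
  by move=> tD; have := hfree t; rewrite tD /= negb_or => /andP[].
have aD t : t \in D -> a i t \in D.
  by move=> tD; have [|] := abD i t _ tD; rewrite ?inE ?eqxx.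
pose Q t := [set t; a i t].
have QE (f : T -> T) t : f (a i t) = a i (f t) -> f @: Q t = Q (f t).
  by move=> fa; rewrite imsetU !imset_set1 fa.
rewrite expnS; apply: leq_trans (@leq_card_fibers2 _ _ Q (a i) D _); last first.
  move=> t tD; split; [exact: aD|exact: (afree t tD).1|].
  by rewrite /Q (heis_aa hR) finset.setUC.
rewrite leq_mul2l /=; apply: (IH _ _ _ _ _ us (heisenberg_rel_imset hR)).
- have /card_gt0P[t tD] := D0.
  by apply/card_gt0P; exists (Q t); apply: imset_f.
- move=> _ /imsetP[t tD ->]; rewrite QE ?(heis_az hR) //; split.
    by apply: imset_f; apply: (zD t tD).1.
  apply/eqP => /finset.setP/(_ (z t)); rewrite !inE eqxx /= (negPf (zD t tD).2) /=.
  by rewrite eq_sym (negPf (afree t tD).2).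
- move=> j _ js /imsetP[t tD ->].
  have [|ajD bjD] := abD j t _ tD; first by rewrite inE js orbT.
  rewrite !QE; first by split; apply: imset_f.
    by rewrite (heis_abC hR) ?neq.
  by rewrite (heis_aC hR).
Qed.

(** * Binary branching in finite trees *)

Section BranchingRank.
Context (T : eqType) (height : T -> nat) (children : T -> seq T) (N D : nat).
Hypothesis uniq_children : forall v, uniq (children v).
Hypothesis size_children : forall v, (size (children v) <= D)%N.
Hypothesis height_children : forall v c, c \in children v -> (height v < height c <= N)%N.

(* [branching k v]: a subdivision of the complete binary tree of depth [k]
   hangs below [v]. *)
Inductive branching : nat -> T -> Prop :=
| Branching0 v : branching 0 v
| BranchingUnary k v c : c \in children v -> branching k c -> branching k v
| BranchingBinary k v c d : c \in children v -> d \in children v -> c != d ->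
    branching k c -> branching k d -> branching k.+1 v.

Lemma branching_pred k v : branching k v -> branching k.-1 v.
Proof.
elim=> {k v} [v|k v c cv _ IH|k v c d cv _ _ bc _ _ _]; first exact: Branching0.
  exact: BranchingUnary cv IH.
exact: BranchingUnary cv bc.
Qed.

Lemma leq_branching j k v : (j <= k)%N -> branching k v -> branching j v.
Proof.
move=> jk; rewrite -(subKn jk); elim: (k - j) => [|i IH]; first by rewrite subn0.
by move=> /IH/branching_pred; rewrite subnS.
Qed.

Lemma branching_height k v : (height v <= N)%N -> branching k v ->
  (k + height v <= N)%N.
Proof.
move=> + b; elim: b => {k v} [v //|k v c cv _ IH|k v c d cv _ _ _ IH _ _] vN.
  by have := height_children cv => /andP[h1 h2]; have := IH h2; lia.
by have := height_children cv => /andP[h1 h2]; have := IH h2; lia.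
Qed.

Lemma branching_max v : (height v <= N)%N ->
  exists2 r, branching r v & forall k, branching k v -> (k <= r)%N.
Proof.
move=> vN; have ex : exists k, `[< branching k v >].
  by exists 0; apply/asboolP/Branching0.
have bnd k : `[< branching k v >] -> (k <= N)%N.
  by move=> /asboolP/(branching_height vN); lia.
case: (ex_maxnP ex bnd) => r /asboolP rv max_r; exists r => // k kv.
by apply: max_r; apply/asboolP.
Qed.

(* [selected v e f]: if [e] is false, [f 0] continues the subdivided edge
   through [v]; otherwise [f 1] and [f 2] are the two subtrees below [v]. *)
Definition selected (v : T) (e : bool) (f : 'I_3 -> option T) : Prop :=
  [/\ forall i c, f i = Some c -> c \in children v,
      forall i j c, f i = Some c -> f j = Some c -> i = j,
      e = false -> exists2 c, f ord0 = Some c &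
        forall k, branching k v -> branching k c &
      e = true -> forall (i : 'I_3) k, i != ord0 -> branching k.+1 v ->
        exists2 c, f i = Some c & branching k c].

(** Take the largest [r] with [branching r v]. The last rule of its derivation decides whether [v]
    becomes a unary or a binary node, and maximality of [r] makes this one choice serve all ranks at
    once. *)
Lemma exists_selected v : (height v <= N)%N -> exists e f, selected v e f.
Proof.
move=> vN; have [r rv max_r] := branching_max vN.
case: r v / rv vN max_r => [v|r v c cv rc|r v c d cv dv cd rc rd] vN max_r.
(* The largest rank is [0] here, so the clause on binary nodes is vacuous. *)
- exists true, (fun=> None); split=> // _ i k _ /max_r; by rewrite ltn0.
- exists false, (fun i : 'I_3 => if i == ord0 then Some c else None); split=> //.
  + by move=> i c'; case: ifP => // _ [<-].
  + by move=> i j c'; case: eqP => // ->; case: eqP => // ->.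
  + by move=> _; exists c => // k /max_r kr; apply: leq_branching rc.
- exists true, (fun i : 'I_3 => nth None [:: None; Some c; Some d] i); split=> //.
  + by case=> [[|[|[|i]]] hi] //= c' [<-].
  + case=> [[|[|[|i]]] hi] //= [[|[|[|j]]] hj] //= c' [<-] // dc;
      by [apply: val_inj|case: dc cd => ->; rewrite eqxx].
  + move=> _ [[|[|[|i]]] hi] //= k _ /max_r kr; [exists c|exists d] => //.
      exact: leq_branching rc.
    exact: leq_branching rd.
Qed.

Fixpoint descendants (n : nat) (v : T) : seq T :=
  if n is n'.+1 then v :: flatten [seq descendants n' c | c <- children v]
  else [:: v].

Lemma mem_descendants n v : v \in descendants n v.
Proof. by case: n => [|n]; rewrite mem_head. Qed.

Lemma descendants_child n v w c :
  w \in descendants n v -> c \in children w -> c \in descendants n.+1 v.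
Proof.
elim: n v => [|n IH] v.
  rewrite inE => /eqP -> cv; rewrite /= inE; apply/orP; right.
  by apply/flattenP; exists [:: c]; rewrite ?mem_head //; apply/mapP; exists c.
rewrite inE => /predU1P[->|/flattenP[_ /mapP[d dv ->] wd]] cw.
  rewrite inE; apply/orP; right; apply/flattenP.
  by exists (descendants n.+1 c); rewrite ?mem_descendants //; apply/mapP; exists c.
rewrite inE; apply/orP; right; apply/flattenP.
by exists (descendants n.+1 d); [apply/mapP; exists d|apply: IH wd cw].
Qed.

Lemma sumn_exceptional (s : seq T) (P : T -> Prop) (f : T -> nat) a b :
    uniq s -> (forall c d, c \in s -> d \in s -> P c -> P d -> c = d) ->
    (forall c, c \in s -> P c -> (f c <= b)%N) ->
    (forall c, c \in s -> ~ P c -> (f c <= a)%N) ->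
  (sumn [seq f c | c <- s] <= size s * a + b)%N.
Proof.
elim: s => [//|c s IH] /= /andP[cs us] one fP fN.
have [Pc|nPc] := pselect (P c); last first.
  rewrite mulSn -addnA leq_add ?fN ?mem_head // IH // => x.
  - by move=> y xs ys; apply: one; rewrite inE ?xs ?ys orbT.
  - by move=> xs; apply: fP; rewrite inE xs orbT.
  - by move=> xs; apply: fN; rewrite inE xs orbT.
have fNs d : d \in s -> (f d <= a)%N.
  move=> ds; apply: fN; first by rewrite inE ds orbT.
  move=> Pd; move: cs; rewrite (one c d) ?mem_head ?ds //.
  by rewrite inE ds orbT.
have : (sumn [seq f c | c <- s] <= size s * a)%N.
  elim: s {IH us one cs fP fN} fNs => [//|d s IH] fNs /=.
  rewrite mulSn leq_add ?IH ?fNs ?mem_head // => e es.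
  by apply: fNs; rewrite inE es orbT.
by have := fP c (mem_head _ _) Pc; lia.
Qed.

(** If [v] has no branching of rank [k + 2], at most one child has rank [k + 1], since two such
    children would be joined at [v]. A bound [s(n, k)] thus propagates by [s(n + 1, k + 1) >= 1 + D
    * s(n, k) + s(n, k + 1)]. For [k = 0] the descendants form a single path. *)
Lemma size_descendants n k v : ~ branching k.+1 v ->
  (size (descendants n v) <= D.+1 ^ k * n.+1 ^ k.+1)%N.
Proof.
elim: n k v => [|n IH] k v nb; first by rewrite /= exp1n muln1 expn_gt0.
rewrite /= size_flatten /shape -map_comp.
have one j c d : ~ branching j.+1 v -> c \in children v -> d \in children v ->
    branching j c -> branching j d -> c = d.
  move=> nj cv dv jc jd; have [//|cd] := eqVneq c d.
  by case: nj; apply: BranchingBinary cd jc jd.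
have nbc c : c \in children v -> ~ branching k.+1 c.
  by move=> cv bc; apply: nb; apply: BranchingUnary cv bc.
case: k nb nbc => [|k] nb nbc.
  rewrite expn0 mul1n expn1 ltnS.
  have one01 c d : c \in children v -> d \in children v -> c = d.
    by move=> cv dv; apply: one nb cv dv (Branching0 _) (Branching0 _).
  case: (children v) (uniq_children v) one01 nbc => [//|c [|d s]] /=.
    move=> _ _ /(_ c (mem_head _ _)) /IH.
    by rewrite expn0 mul1n expn1 addn0.
  move=> /andP[cds _] one01 _; move: cds.
  by rewrite (one01 c d) ?inE ?eqxx ?orbT.
have := @sumn_exceptional (children v) (branching k.+1) (size \o descendants n)
  (D.+1 ^ k * n.+1 ^ k.+1) (D.+1 ^ k.+1 * n.+1 ^ k.+2) (uniq_children v)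
  (fun c d => one k.+1 c d nb) (fun c cv _ => IH _ _ (nbc c cv))
  (fun c _ nc => IH _ _ nc).
rewrite (expnSr n.+1 k.+1) (expnS D.+1) => le_sm; have le_D := size_children v.
set a := (D.+1 ^ k)%N in le_sm *; set m := (n.+1 ^ k.+1)%N in le_sm *.
have t_gt0 : (0 < a * m)%N by rewrite muln_gt0 !expn_gt0.
have le_q : (D.+1 * a * (m * n.+2) <= D.+1 * a * n.+2 ^ k.+2)%N.
  by rewrite leq_mul2l expnSr leq_mul2r leq_exp2r // leqnSn !orbT.
have le_s : (size (children v) * (a * m) <= D * (a * m))%N by rewrite leq_mul2r le_D orbT.
have qE : (D.+1 * a * (m * n.+2) = D.+1 * a * (m * n.+1) + D * (a * m) + a * m)%N.
  by rewrite (mulnS m) mulnDr !mulSn; nia.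
apply: leq_trans le_q; rewrite qE; apply: leq_ltn_trans le_sm _; lia.
Qed.
End BranchingRank.

Local Open Scope classical_set_scope.
Local Open Scope group_scope.

(** * Memory of cellular automata and periodic configurations *)

Lemma nbhs_config_cell (G : groupType) (A : finType) (x : config G A) (g : G) :
  nbhs x [set y : config G A | y g = x g].
Proof.
have := @proj_continuous G (fun=> discrete_topology A) g x [set x g].
by apply; exact: discrete_set1.
Qed.

Section ConfigTopology.
Context (G : groupType) (A : finType).
Local Notation X := (config G A).

Lemma nbhs_config_window (x : X) (W : seq G) :
  nbhs x [set y : X | {in W, y =1 x}].
Proof.
elim: W => [|g W IH]; first by apply: filterS filterT.
apply: filterS (filterI (nbhs_config_cell x g) IH) => y [/= yg yW] h.
by rewrite inE => /orP[/eqP -> //|/yW].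
Qed.

Lemma nbhs_configP (x : X) (U : set X) :
  nbhs x U -> exists W : seq G, forall y : X, {in W, y =1 x} -> U y.
Proof.
case=> P [[Q QfinP <-] [V QV Vx] QU].
have [L Lsub VL] := QfinP _ QV.
have /choice[h hP] : forall M, exists g : G,
    M \in L -> forall y : X, y g = x g -> M y.
  move=> M; case: (boolP (M \in L)) => LM; last by exists 1.
  have /set_mem [g _ [C _ OM]] := Lsub _ LM.
  exists g => _ y yg; rewrite -OM /= yg; move: Vx; rewrite -VL => /(_ _ LM).
  by rewrite -OM.
exists [seq h M | M <- L] => y yW; apply: QU; exists V => //.
suff : V y by []; rewrite -VL => M LM; apply: (hP _ LM); apply: yW.
by apply/mapP; exists M.
Qed.

End ConfigTopology.

Lemma continuous_configP (G H : groupType) (A B : finType)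
    (f : config G A -> config H B) :
  continuous f <->
  forall x h, exists W : seq G, forall y, {in W, y =1 x} -> f y h = f x h.
Proof.
split=> [cf x h|fW x].
  exact: nbhs_configP (cf x _ (nbhs_config_cell (f x) h)).
move=> U /nbhs_configP[V VU].
have [W WV] : exists W : seq G, forall y, {in W, y =1 x} -> {in V, f y =1 f x}.
  elim: V {VU} => [|h V [W WV]]; first by exists [::].
  have [W' fE] := fW x h; exists (W' ++ W) => y yW k; rewrite inE.
  move=> /orP[/eqP->|kV]; first by apply: fE => g gW; rewrite yW // mem_cat gW.
  by apply: WV k kV => g gW; rewrite yW // mem_cat gW orbT.
by apply: filterS (nbhs_config_window x W) => y /WV /VU.
Qed.

Lemma config_compact (G : groupType) (A : finType) : compact [set: config G A].
Proof.
have -> : [set: config G A] = [set f : config G A | forall g, [set: A] (f g)].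
  by apply/seteqP; split.
apply: (@tychonoff G (fun=> discrete_topology A) (fun=> setT)) => g.
exact: (@finite_compact (discrete_topology A) setT finite_finset).
Qed.

(** Compactness makes the local dependence at each configuration uniform. This is one half of the
    Curtis-Hedlund-Lyndon theorem, for an arbitrary exhaustion [K] of the group. *)
Lemma shift_aut_memory (G : groupType) (A : finType) (f : shift_aut G A) (K : nat -> G -> Prop) :
    (forall g, exists n0, forall n, (n0 <= n)%N -> K n g) ->
  exists n, forall x y : config G A, (forall g, K n g -> x g = y g) -> f x 1 = f y 1.
Proof.
move=> KP; have [[h [_ _ cf _]] _] := shift_autP f.
pose P n (x : config G A) :=
  forall y : config G A, (forall g, K n g -> x g = y g) -> f x 1 = f y 1.
have /compact_near_coveringP cP := @config_compact G A.
have [|n0 _ n0P] := cP nat \oo P _; last first.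
  by exists n0 => x y; exact: (n0P n0 (leqnn _) x I).
move=> x _; have [W WP] := (continuous_configP f).1 cf x 1.
have [n0 n0P] : exists n0, forall n, (n0 <= n)%N -> forall g, g \in W -> K n g.
  elim: W {WP} => [|g W [n0 n0P]]; first by exists 0%N.
  have [n1 n1P] := KP g; exists (maxn n0 n1) => n.
  rewrite geq_max => /andP[nn0 nn1] k; rewrite inE => /orP[/eqP->|].
    exact: n1P.
  exact: n0P.
exists ([set y : config G A | {in W, y =1 x}], [set n | (n0 <= n)%N]).
  by split; [exact: nbhs_config_window | exists n0].
move=> [y n] [/= yW nn] y' yy'; rewrite (WP _ yW) WP // => g gW.
by rewrite -yy' ?yW //; exact: n0P.
Qed.

Record heisenberg_family (I : eqType) (K : groupType) (z : K) (a b : I -> K) :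
    Prop := HeisenbergFamily {
  hfam_zz : z * z = 1;
  hfam_aa : forall i, a i * a i = 1;
  hfam_bb : forall i, b i * b i = 1;
  hfam_az : forall i, a i * z = z * a i;
  hfam_bz : forall i, b i * z = z * b i;
  hfam_aC : forall i j, a i * a j = a j * a i;
  hfam_bC : forall i j, b i * b j = b j * b i;
  hfam_abC : forall i j, i != j -> a i * b j = b j * a i;
  hfam_ab : forall i, a i * b i = b i * (a i * z) }.

Lemma heisenberg_family_act (I : eqType) (K : groupType) (T : Type)
    (act : K -> T -> T) (z : K) (a b : I -> K) :
    (forall t, act 1 t = t) -> (forall g h t, act (g * h) t = act g (act h t)) ->
  heisenberg_family z a b ->
  heisenberg_rel (act z) (fun i => act (a i)) (fun i => act (b i)).
Proof.
move=> act1 actM [zz aa bb az bz aC bC abC ab].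
split=> *; rewrite -?actM.
- by rewrite zz act1.
- by rewrite aa act1.
- by rewrite bb act1.
- by rewrite az.
- by rewrite bz.
- by rewrite aC.
- by rewrite bC.
- by rewrite abC.
- by rewrite ab mulgA.
Qed.

Lemma is_subgroupM (K : groupType) (H : set K) x y :
  is_subgroup H -> H x -> H y -> H (x * y).
Proof.
move=> [H1 HV] Hx Hy; rewrite -[y]invgK; apply: (HV) => //.
by rewrite -[y^-1]mul1g; apply: HV.
Qed.

Lemma heisenberg_family_morph (I : eqType) (K L : groupType) (H : set K)
    (f : K -> L) (z : K) (a b : I -> K) :
    is_subgroup H -> {in H &, {morph f : x y / x * y}} ->
    H z -> (forall i, H (a i)) -> (forall i, H (b i)) ->
  heisenberg_family z a b ->
  heisenberg_family (f z) (fun i => f (a i)) (fun i => f (b i)).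
Proof.
move=> [H1 HV] fM Hz Ha Hb [zz aa bb az bz aC bC abC ab].
have HM x y : H x -> H y -> H (x * y) by apply: is_subgroupM.
have fM' x y : H x -> H y -> f (x * y) = f x * f y by move=> *; apply: fM; rewrite in_setE.
have f1 : f 1 = 1.
  by apply: (mulgI (f 1)); rewrite -fM' ?mulg1.
split=> [|i|i|i|i|i j|i j|i j ij|i]; rewrite -?fM' //; try exact: HM.
- by rewrite zz.
- by rewrite aa.
- by rewrite bb.
- by rewrite az.
- by rewrite bz.
- by rewrite aC.
- by rewrite bC.
- by rewrite abC.
- by rewrite ab.
Qed.

(** * Configurations of odd period, seen on finite tori *)

Section CenteredResidue.
Variable n : nat.
Local Open Scope ring_scope.
Let p : nat := n.*2.+1.

(** With the odd modulus [2 * n + 1], the integers of absolute value at most [n] represent each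
    class exactly once. *)
Definition residue (k : int) : 'I_n.*2.+1 := inord (absz (k %% p)%Z).
Definition centered (t : 'I_n.*2.+1) : int :=
  if (t <= n)%N then t%:Z else t%:Z - p%:Z.

Lemma residueE k : (residue k : nat)%:Z = (k %% p)%Z.
Proof.
have pos : 0 <= (k %% p)%Z by exact: modz_ge0.
rewrite inordK ?gez0_abs //.
by rewrite -ltz_nat gez0_abs // ltz_pmod.
Qed.

Lemma centeredK : cancel centered residue.
Proof.
move=> t; apply/val_inj/eqP; rewrite -eqz_nat residueE /centered.
have tp : (t%:Z %% p)%Z = t by rewrite modz_small // ltz_nat ltn_ord.
case: ifP => _; rewrite ?tp //.
by rewrite addrC -mulN1r modzMDl tp.
Qed.

Lemma centered_eq k : exists q : int, centered (residue k) = k + q * p%:Z.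
Proof.
rewrite /centered residueE; have := divz_eq k p; set q := (k %/ p)%Z => kE.
case: ifP => _; [exists (- q)|exists (- q - 1)]; lia.
Qed.

Lemma centered_bound t : (absz (centered t) <= n)%N.
Proof. by rewrite /centered; have := ltn_ord t; case: ifP; rewrite /p; lia. Qed.

Lemma residueK k : (absz k <= n)%N -> centered (residue k) = k.
Proof.
move=> kn; have [q qE] := centered_eq k.
have := centered_bound (residue k); rewrite qE.
have -> : q = 0 :> int by have := centered_bound (residue k); rewrite qE /p; nia.
by rewrite mul0r addr0.
Qed.

Lemma residueDl k l : residue (centered (residue k) + l) = residue (k + l).
Proof.
have [q ->] := centered_eq k; apply/val_inj/eqP; rewrite -eqz_nat !residueE.
by rewrite addrAC addrC modzMDl.
Qed.
End CenteredResidue.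

Section PeriodicConfigurations.
Variables (d : nat) (B : finType).
Local Notation K := (Zpow d).
Local Notation X := (config K B).

Definition in_box (n : nat) (v : K) : Prop :=
  forall i, (absz ((v : 'rV[int]_d) ord0 i) <= n)%N.

Definition has_radius (n : nat) (f : shift_aut K B) : Prop :=
  forall x y : X, (forall v, in_box n v -> x v = y v) -> f x 1 = f y 1.

Lemma shift_aut_at (G : groupType) (A : finType) (f : shift_aut G A) x g :
  f x g = f (translate g^-1 x) 1.
Proof. by rewrite (shift_autP f).2 /translate invgK mulg1. Qed.

Lemma exists_radius (f : shift_aut K B) : exists n, has_radius n f.
Proof.
have [|n nP] := @shift_aut_memory _ _ f in_box; last by exists n.
move=> v; exists (\max_i absz ((v : 'rV[int]_d) ord0 i))%N => n le_n i.
exact: leq_trans (leq_bigmax i) le_n.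
Qed.

Lemma has_radius_leq n m f : (n <= m)%N -> has_radius n f -> has_radius m f.
Proof.
by move=> nm fn x y xy; apply: fn => v vn; apply: xy => i; apply: leq_trans nm.
Qed.

Lemma has_radius1 n : has_radius n 1.
Proof. by move=> x y xy; apply: xy => i; rewrite mxE. Qed.

Lemma has_radiusM n m f g :
  has_radius n f -> has_radius m g -> has_radius (n + m) (f * g).
Proof.
move=> fn gm x y xy; apply: fn => v vn; rewrite [LHS]shift_aut_at [RHS]shift_aut_at.
apply: gm => w wm; rewrite /translate invgK; apply: xy => i.
rewrite mxE; apply: (leq_trans _ (leq_add (vn i) (wm i))).
by apply: (_ : forall k l : int, absz (k + l)%R <= absz k + absz l)%N => k l; lia.
Qed.

Section Torus.
Variable n : nat.
Local Notation T := {ffun {ffun 'I_d -> 'I_n.*2.+1} -> B}.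

Definition to_torus (v : K) : {ffun 'I_d -> 'I_n.*2.+1} :=
  [ffun i => residue n ((v : 'rV[int]_d) ord0 i)].
Definition of_torus (t : {ffun 'I_d -> 'I_n.*2.+1}) : K :=
  (\row_i centered (t i))%R.
Definition periodize (c : T) : X := fun v => c (to_torus v).
Definition torus_act (f : shift_aut K B) (c : T) : T :=
  [ffun t => f (periodize c) (of_torus t)].

Lemma of_torusK : cancel of_torus to_torus.
Proof. by move=> t; apply/ffunP => i; rewrite ffunE mxE centeredK. Qed.

Lemma to_torusK v : in_box n v -> of_torus (to_torus v) = v.
Proof.
by move=> vn; apply/rowP => i; rewrite mxE ffunE residueK.
Qed.

Lemma to_torusMl v w : to_torus (of_torus (to_torus v) * w) = to_torus (v * w).
Proof. by apply/ffunP => i; rewrite !ffunE !mxE ffunE residueDl. Qed.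

(** By equivariance the image of a periodic configuration has the same periods, so its values at the
    representatives of the torus determine it. *)
Lemma torus_actK f c : periodize (torus_act f c) = f (periodize c).
Proof.
apply/funext => v; rewrite /periodize ffunE [LHS]shift_aut_at [RHS]shift_aut_at.
congr (aut_fun f _ _); apply/funext => w.
by rewrite /translate /periodize !invgK to_torusMl.
Qed.

Lemma periodize_inj : injective periodize.
Proof.
move=> c c' /(congr1 (fun x => x \o of_torus)) cc'; apply/ffunP => t.
by have := congr1 (@^~ t) cc'; rewrite /= /periodize of_torusK.
Qed.

Lemma torus_act1 c : torus_act 1 c = c.
Proof. by apply: periodize_inj; rewrite torus_actK. Qed.

Lemma torus_actM f g c : torus_act (f * g) c = torus_act f (torus_act g c).
Proof. by apply: periodize_inj; rewrite !torus_actK. Qed.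

(** Move a cell changed by [f] to the origin, keep the configuration on the box of radius [n] and
    repeat it periodically: at the origin [f] sees only that box. *)
Lemma torus_act_faithful f : has_radius n f -> f != 1 -> exists c, torus_act f c != c.
Proof.
move=> fn f1; have [x [v fxv]] : exists x v, f x v <> x v.
  apply: contrapT => nex; move/eqP: f1; apply; apply: val_inj; apply/funext => x.
  by apply/funext => v; apply: contrapT => fxv; apply: nex; exists x, v.
pose y := translate v^-1 x; have fy : f y 1 <> y 1.
  by rewrite -shift_aut_at /y /translate invgK mulg1.
exists [ffun t => y (of_torus t)]; apply/eqP => /(congr1 periodize).
rewrite torus_actK => /(congr1 (@^~ 1)); rewrite -(fn y).
  by rewrite /periodize ffunE to_torusK // => i; rewrite mxE.
by move=> w wn; rewrite /periodize ffunE to_torusK.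
Qed.

Lemma heisenberg_family_bound (I : eqType) (s : seq I) (z : shift_aut K B)
    (a b : I -> shift_aut K B) :
    uniq s -> has_radius n z -> z != 1 -> heisenberg_family z a b ->
  (2 ^ size s <= #|B| ^ (n.*2.+1 ^ d))%N.
Proof.
move=> us zn z1 hf.
have hR := heisenberg_family_act torus_act1 torus_actM hf.
have [c zc] := torus_act_faithful zn z1.
(* The torus configurations moved by [z] form a nonempty set, stable under the family because the
   family commutes with [z]. *)
apply: leq_trans (_ : #|[set c : T | torus_act z c != c]%SET| <= _)%N; last first.
  by apply: leq_trans (max_card _) _; rewrite !card_ffun card_ord card_ord.
apply: (heisenberg_card us hR).
- by apply/card_gt0P; exists c; rewrite inE.
- by move=> t; rewrite !inE => zt; split=> //; rewrite (inj_eq (can_inj (heis_zz hR))).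
- move=> i t _; rewrite !inE => zt.
  rewrite -(heis_az hR) -(heis_bz hR).
  by rewrite (inj_eq (can_inj (heis_aa hR i))) (inj_eq (can_inj (heis_bb hR i))).
Qed.
End Torus.
End PeriodicConfigurations.

(** * Word length and its effect on the radius *)

Inductive word_length (K : groupType) (T : set K) : nat -> K -> Prop :=
| WordLength1 : word_length T 0 1
| WordLengthGen g : T g -> word_length T 1 g
| WordLengthM m n g h :
    word_length T m g -> word_length T n h -> word_length T (m + n) (g * h).

Lemma word_lengthV (K : groupType) (T : set K) n g :
    (forall h, T h -> T h^-1) ->
  word_length T n g -> word_length T n g^-1.
Proof.
move=> TV; elim=> [|{}g gT|m {}n {}g h _ IHg _ IHh].
- by rewrite invg1; apply: WordLength1.
- exact/WordLengthGen/TV.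
- by rewrite invgM addnC; apply: WordLengthM.
Qed.

Lemma word_length_generated (K : groupType) (T : set K) n g :
  word_length T n g -> generated T g.
Proof.
have sT := is_subgroup_generated T.
elim=> [|{}g gT M [_]|m {}n {}g h _ Hg _ Hh]; [exact: sT.1|exact|].
exact: is_subgroupM sT Hg Hh.
Qed.

Lemma has_radius_word_length (K : groupType) (T : set K) (d : nat) (B : finType)
    (f : K -> shift_aut (Zpow d) B) (r : nat) n g :
    {in generated T &, {morph f : x y / x * y}} ->
    (forall g, T g -> has_radius r (f g)) ->
  word_length T n g -> has_radius (n * r) (f g).
Proof.
move=> fM rP; have sT := is_subgroup_generated T.
elim=> [|{}g gT|{}m {}n {}g h gl IHg hl IHh].
- have -> : f 1 = 1.
    by apply: (mulgI (f 1)); rewrite -fM ?in_setE ?mulg1 //; exact: sT.1.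
  exact: has_radius1.
- by rewrite mul1n; apply: rP.
- have Hg := word_length_generated gl; have Hh := word_length_generated hl.
  by rewrite mulnDl fM ?in_setE //; apply: has_radiusM.
Qed.

(** * Word norm, growth and nets *)

Lemma ball_growth (R : realType) (G : groupType) :
    stretched_exp_growth R G ->
  exists S : set G, [/\ finite_set S, generated S = [set: G] &
    exists K m0 : nat, forall m, (m0 <= m)%N ->
      (2 ^ (m ^ 2) <= #|` fset_set (word_ball S (m ^ K))|)%N].
Proof.
case=> S [finS genS [beta beta_gt0 /asboolP Om]].
exists S; split=> //.
have [c c_gt0 [n0 _ n0P]] : exists2 c : R, (0 < c)%R & \forall k \near \oo,
    (c * expR (k%:R `^ beta) <= #|` fset_set (word_ball S k)|%:R :> R)%R.
  have [c [c_gt0 cP]] := Om; exists c => //.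
  apply: filterS cP => k /=; rewrite ger0_norm ?expR_ge0 // ger0_norm //.
(* This exponent makes the [beta]-th power of [m ^ K.+1] at least [m ^ 3]; the surplus of [m ^ 3]
   over [m ^ 2] absorbs the constant [c]. *)
pose K := Num.trunc (3 / beta)%R; exists K.+1.
exists (maxn n0.+2 (Num.trunc (c^-1)%R).+2) => m; rewrite geq_max => /andP[mn0 mc].
have m_ge2 : (2 <= m)%N by lia.
have Kbeta : (3 <= K.+1%:R * beta)%R.
  by rewrite -ler_pdivrMr // ltW // truncnS_gt.
have cm : (c^-1 <= m%:R)%R.
  by apply: ltW; apply: lt_le_trans (truncnS_gt _) _; rewrite ler_nat ltnW.
have le_m : (n0 <= m ^ K.+1)%N.
  have := @leq_pexp2l m 1 K.+1; rewrite expn1 => /(_ _ _) mK.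
  by apply: leq_trans (mK _ _); lia.
rewrite -(ler_nat R); apply: le_trans (n0P _ le_m).
have m1 : (1 <= m%:R :> R)%R by rewrite ler1n; lia.
apply: (@le_trans _ _ (c * expR ((m ^ 3)%N%:R))%R); last first.
  rewrite ler_pM2l // ler_expR natrX natrX -!powR_mulrn //; try lra.
  by rewrite -powRrM ler_powR.
rewrite -[(m ^ 3)%N%:R%R]mulr1 expRM_natl.
apply: (@le_trans _ _ (c * (2 ^+ (m ^ 3)%N))%R); last first.
  rewrite ler_pM2l //; apply: lerXn2r; rewrite ?nnegrE ?expR_ge0 //.
  by have := @expR_ge1Dx R 1; lra.
rewrite -ler_pdivrMl //.
have mm : (m <= 2 ^ (m ^ 3 - m ^ 2))%N.
  apply: (@leq_trans (2 ^ m)%N); first exact/ltnW/ltn_expl.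
  by rewrite leq_exp2l // [(m ^ 3)%N]expnS; nia.
have m32 : (m ^ 3 = (m ^ 3 - m ^ 2) + m ^ 2)%N by rewrite subnK // leq_exp2l; lia.
rewrite m32 exprD natrX ler_pM2r ?exprn_gt0 //.
by apply: le_trans cm _; rewrite -natrX ler_nat.
Qed.

Section WordNorm.
Context (G : groupType) (S : set G).
Hypothesis genS : generated S = [set: G].

Lemma word_ball1 n : word_ball S n 1.
Proof. by exists [::]; split=> //; rewrite big_nil. Qed.

Lemma word_ballM m n g h :
  word_ball S m g -> word_ball S n h -> word_ball S (m + n) (g * h).
Proof.
move=> [u [um uS ->]] [v [vn vS ->]]; exists (u ++ v); split.
- by rewrite size_cat leq_add.
- by move=> s; rewrite mem_cat => /orP[/uS|/vS].
- by rewrite big_cat.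
Qed.

Lemma word_ballV n g : word_ball S n g -> word_ball S n g^-1.
Proof.
move=> [w [wn wS ->]]; exists [seq s^-1 | s <- rev w]; split.
- by rewrite size_map size_rev.
- move=> _ /mapP[s + ->]; rewrite mem_rev => /wS []; last by left.
  by rewrite invgK; right.
- elim: w {wn wS} => [|s w IH]; first by rewrite !big_nil invg1.
  rewrite big_cons invgM IH rev_cons map_rcons -cats1 big_cat /=.
  by rewrite big_seq1.
Qed.

Lemma word_ball_split m n g : word_ball S (m + n) g ->
  exists h k, [/\ word_ball S m h, word_ball S n k & g = h * k].
Proof.
move=> [w [wn wS ->]].
exists (\prod_(s <- take m w) s), (\prod_(s <- drop m w) s); split.
- exists (take m w); split=> //; first by rewrite size_take_min geq_minl.
  by move=> s /mem_take; apply: wS.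
- exists (drop m w); split=> //; first by rewrite size_drop leq_subLR.
  by move=> s /mem_drop; apply: wS.
- by rewrite -big_cat cat_take_drop.
Qed.

Lemma word_ball_exhaust g : exists n, word_ball S n g.
Proof.
have : generated S g by rewrite genS.
move=> /(_ [set h | exists n, word_ball S n h]); apply; split; last first.
  move=> s Ss; exists 1%N, [:: s]; split=> //; last by rewrite big_seq1.
  by move=> t; rewrite inE => /eqP ->; left.
split=> [|x y [m xm] [n yn]]; first by exists 0%N; apply: word_ball1.
by exists (m + n)%N; apply: word_ballM => //; apply: word_ballV.
Qed.

(** When [S] generates the group, every element lies in some ball and the default [0] of [xget] is
    never taken. *)
Definition wnorm (g : G) : nat :=
  xget 0%N [set n | word_ball S n g /\ forall k, word_ball S k g -> (n <= k)%N].

Lemma wnormP n g : (wnorm g <= n)%N <-> word_ball S n g.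
Proof.
have [w wP] : exists n, word_ball S n g /\ forall k, word_ball S k g -> (n <= k)%N.
  have [n0 /asboolP n0P] := word_ball_exhaust g.
  have ex : exists n, `[< word_ball S n g >] by exists n0.
  exists (ex_minn ex); case: ex_minnP => m /asboolP mP min_m; split=> // k kP.
  by apply: min_m; apply/asboolP.
have := @xgetPex _ 0%N [set n | word_ball S n g /\
  forall k, word_ball S k g -> (n <= k)%N] (ex_intro _ w wP).
rewrite -/(wnorm g) => -[ballg ming]; split=> [le_n|/ming //].
have [u [un uS ->]] := ballg; exists u; split=> //; exact: leq_trans le_n.
Qed.

Lemma wnorm1 : wnorm 1 = 0%N.
Proof. by apply/eqP; rewrite -leqn0; apply/wnormP; apply: word_ball1. Qed.

Lemma wnorm_eq0 g : wnorm g = 0%N -> g = 1.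
Proof.
move=> g0; have /wnormP[w [+ _ ->]] : (wnorm g <= 0)%N by rewrite g0.
by rewrite leqn0 size_eq0 => /eqP ->; rewrite big_nil.
Qed.

Lemma wnormV g : wnorm g^-1 = wnorm g.
Proof.
have le g' : (wnorm g'^-1 <= wnorm g')%N.
  by apply/wnormP; apply: word_ballV; apply/wnormP.
by apply/eqP; rewrite eqn_leq le -{1}[g]invgK le.
Qed.

Lemma wnormM g h : (wnorm (g * h) <= wnorm g + wnorm h)%N.
Proof. by apply/wnormP; apply: word_ballM; apply/wnormP. Qed.

(** Cut a geodesic word after [n] letters; the triangle inequality makes both pieces geodesic. *)
Lemma wnorm_split g n : (n <= wnorm g)%N ->
  exists h k, [/\ wnorm h = n, wnorm k = (wnorm g - n)%N & g = h * k].
Proof.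
move=> le_n; have /wnormP : (wnorm g <= n + (wnorm g - n))%N by rewrite subnKC.
move=> /word_ball_split[h [k [/wnormP hn /wnormP kn gE]]]; exists h, k.
by have := wnormM h k; rewrite -gE; split=> //; lia.
Qed.

Hypothesis finS : finite_set S.

Definition wball (n : nat) : seq G := fset_set (word_ball S n).

Lemma mem_wball n g : (g \in wball n) = (wnorm g <= n)%N.
Proof.
rewrite /wball in_fset_set; last exact: finite_word_ball.
by apply/idP/idP; rewrite in_setE => /wnormP.
Qed.

Lemma uniq_wball n : uniq (wball n).
Proof. exact: fset_uniq. Qed.

Lemma leq_wball_mul m n : (size (wball (m + n)) <= size (wball m) * size (wball n))%N.
Proof.
rewrite -(size_allpairs (fun h k => h * k)).
apply: uniq_leq_size (uniq_wball _) _ => g; rewrite mem_wball => /wnormP.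
move=> /word_ball_split[h [k [/wnormP hm /wnormP kn ->]]].
by apply/allpairsP; exists (h, k); rewrite !mem_wball.
Qed.

Lemma leq_wball_exp n : (size (wball n) <= size (wball 1) ^ n)%N.
Proof.
elim: n => [|n IH].
  rewrite expn0 -[1%N]/(size [:: (1 : G)]); apply: uniq_leq_size (uniq_wball _) _.
  by move=> g; rewrite mem_wball leqn0 inE => /eqP/wnorm_eq0/eqP.
rewrite -add1n expnD expn1; apply: leq_trans (leq_wball_mul _ _) _.
by rewrite leq_mul.
Qed.

Lemma wball_gt0 n : (0 < size (wball n))%N.
Proof.
have : 1 \in wball n by rewrite mem_wball wnorm1.
by case: (wball n).
Qed.

(* If no element had norm [n], every geodesic would stop before length [n]. *)
Lemma exists_wnorm n : (forall k, exists m, (k < size (wball m))%N) ->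
  exists g, wnorm g = n.
Proof.
move=> /(_ (size (wball n))) [m lt_m].
have /allPn[g gm]: ~~ all [in wball n] (wball m).
  apply: contraL lt_m => /allP sub; rewrite -leqNgt.
  exact: uniq_leq_size (uniq_wball _) sub.
rewrite /= mem_wball -ltnNge => /ltnW/wnorm_split[h [_ [hn _ _]]].
by exists h.
Qed.
End WordNorm.

(** Since [m <= 3 * m./2] for large [m], one factor [m./2] can be split off and bounded by
    [2 ^ m./2], and induction bounds the rest by [2 ^ m./2] as well. *)
Lemma leq_poly_exp k a : exists m0, forall m, (m0 <= m)%N -> (a * m ^ k <= 2 ^ m)%N.
Proof.
elim: k a => [|k IH] a.
  by exists a => m am; rewrite muln1 (leq_trans am) // ltnW // ltn_expl.
have [m0 m0P] := IH (a * 3 ^ k.+1)%N; exists (m0.*2 + 2)%N => m m_ge.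
have h_ge : (m0 <= m./2)%N by lia.
have m_le : (m <= 3 * m./2)%N by lia.
apply: (@leq_trans (a * (3 * m./2) ^ k.+1)); first by rewrite leq_mul2l leq_exp2r ?m_le ?orbT.
rewrite expnMn mulnA (expnSr m./2) mulnA.
apply: (@leq_trans (2 ^ m./2 * 2 ^ m./2)).
  by apply: leq_mul; [exact: m0P|exact/ltnW/ltn_expl].
by rewrite -expnD leq_exp2l //; lia.
Qed.

Section Net.
Context (G : groupType) (S : set G).
Hypothesis genS : generated S = [set: G].
Hypothesis finS : finite_set S.
Local Notation nrm := (wnorm S).

(** Greedy construction: a point joins the net only if no earlier net point lies within distance
    [r]. *)
Lemma exists_net (r : nat) (s : seq G) : exists V : seq G,
  [/\ uniq V, 1 \in V, {subset V <= 1 :: s},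
      {in V &, forall v w, v != w -> (r < nrm (v^-1 * w))%N} &
      {in s, forall g, exists2 v, v \in V & (nrm (v^-1 * g) <= r)%N}].
Proof.
elim: s => [|g s [V [uV V1 sV sepV covV]]].
  exists [:: 1]; split=> //; first by rewrite mem_head.
  by move=> v w; rewrite !inE => /eqP -> /eqP ->; rewrite eqxx.
have sub : {subset V <= 1 :: g :: s}.
  by move=> v /sV; rewrite !inE => /orP[->|->] //; rewrite !orbT.
have [/hasP[v vV vg]|/hasPn far] := boolP (has (fun v => nrm (v^-1 * g) <= r)%N V).
  exists V; split=> // h; rewrite inE => /predU1P[->|]; last exact: covV.
  by exists v.
have gV : g \notin V.
  by apply/negP => /far; rewrite mulVg wnorm1.
exists (g :: V); split.
- by rewrite /= gV.
- by rewrite inE V1 orbT.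
- by move=> v; rewrite inE => /predU1P[->|/sub //]; rewrite !inE eqxx orbT.
- move=> v w; rewrite !inE => /predU1P[->|vV] /predU1P[->|wV]; rewrite ?eqxx // => vw.
  + by rewrite -(wnormV genS) invgM invgK ltnNge far.
  + by rewrite ltnNge far.
  + exact: sepV.
- move=> h; rewrite inE => /predU1P[->|/covV[v vV vh]].
    by exists g; rewrite ?mem_head // mulVg wnorm1.
  by exists v; rewrite ?inE ?vV ?orbT.
Qed.

Context (r : nat).
Local Notation hops := (wball S (2 * r + 1)).

Definition net_hop (i : 'I_(size hops)) : G := nth 1 hops i.

(** To find the parent of a net point [c] other than [1], go back [r + 1] steps on a geodesic from
    [1] to [c] and take a net point within [r] of the place reached. Its norm is smaller, and the
    hop from it to [c] has norm at most [2 * r + 1]. Hence every net point descends from [1], and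
    balls of radius [r] around the net cover the large ball. *)
Lemma exists_net_tree (N : nat) : exists (V : seq G) (children : G -> seq G)
    (idx : G -> 'I_(size hops)),
  [/\ [/\ 1 \in V, {in V &, forall v w, v != w -> (r < nrm (v^-1 * w))%N} &
      {in V, forall v, (nrm v <= N)%N}],
      [/\ forall v c, c \in children v -> (v \in V) && (c \in V),
      forall v c, c \in children v -> c = v * net_hop (idx c) &
      forall v c, c \in children v -> (nrm v < nrm c <= N)%N],
      [/\ forall v, uniq (children v) & forall v, (size (children v) <= size hops)%N] &
      forall n, (N <= n)%N ->
        (size (wball S N) <= size (descendants children n 1%g) * size (wball S r))%N].
Proof.
have [V [uV V1 sV sepV covV]] := exists_net r (wball S N).
have V_norm : {in V, forall v, (nrm v <= N)%N}.
  move=> v /sV; rewrite inE mem_wball // => /predU1P[->|//].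
  by rewrite wnorm1.
have i0 : 'I_(size hops) by exists 0%N; apply: wball_gt0.
have /choice[idx idxP] : forall c, exists i : 'I_(size hops), c \in V -> c != 1 ->
    (c * (net_hop i)^-1 \in V) && (nrm (c * (net_hop i)^-1) < nrm c)%N.
  move=> c; have [cV|_] := boolP (c \in V); last by exists i0.
  have [->|c1] := eqVneq c 1; first by exists i0.
  have := sepV 1 c V1 cV; rewrite eq_sym invg1 mul1g => /(_ c1) rc.
  have [|g [h [gn hn cE]]] := @wnorm_split _ _ genS c (nrm c - r.+1); first by lia.
  have [|v vV vg] := covV g.
    by rewrite mem_wball //; have := V_norm c cV; lia.
  have hop_in : v^-1 * c \in hops.
    rewrite mem_wball // cE mulgA.
    have hr : nrm h = r.+1 by rewrite hn subKn.
    by apply: leq_trans (wnormM genS _ _) (leq_trans (leq_add vg (leqnn _)) _); lia.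
  have lt_i : (index (v^-1 * c)%g hops < size hops)%N by rewrite index_mem.
  exists (Ordinal lt_i) => _ _.
  have -> : c * (net_hop (Ordinal lt_i))^-1 = v.
    by rewrite /net_hop nth_index // invgM invgK mulgA mulgV mul1g.
  rewrite vV /=; have := wnormM genS g (v^-1 * g)^-1.
  by rewrite wnormV // invgM invgK mulgA mulgV mul1g; lia.
pose children v := [seq c <- V | (c != 1) && (c == v * net_hop (idx c))].
have childP v c : c \in children v ->
    [/\ c \in V, c != 1, c = v * net_hop (idx c) & v = c * (net_hop (idx c))^-1].
  rewrite mem_filter => /andP[/andP[c1 /eqP cE] cV]; split=> //.
  by rewrite {1}cE mulgK.
have child_norm v c : c \in children v -> (nrm v < nrm c <= N)%N.
  by move=> /childP[cV c1 _ ->]; have /andP[_ ->] := idxP c cV c1; exact: V_norm.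
exists V, children, idx; split; [by []| |split|].
- split=> // v c /childP[cV c1 cE vE] //.
  by rewrite cV vE andbT; have /andP[] := idxP c cV c1.
- by move=> v; rewrite filter_uniq.
- move=> v; rewrite -[size hops]size_enum_ord -(size_map (fun i => v * net_hop i)).
  apply: uniq_leq_size; first by rewrite filter_uniq.
  move=> c /childP[_ _ -> _]; apply: map_f.
  by rewrite mem_enum.
have reach n w : w \in V -> (nrm w <= n)%N -> w \in descendants children n 1%g.
  elim: n w => [|n IH] w wV wn.
    have -> : w = 1 by apply: (wnorm_eq0 genS); lia.
    exact: mem_descendants.
  have [->|w1] := eqVneq w 1; first exact: mem_descendants.
  have /andP[pV pn] := idxP w wV w1.
  apply: descendants_child (IH _ pV _) _; first by lia.
  by rewrite mem_filter w1 wV mulgVK eqxx.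
move=> n Nn; rewrite -(size_allpairs (fun h k => h * k)).
apply: uniq_leq_size (uniq_wball _ _) _ => g gN.
have [v vV vg] := covV g gN; apply/allpairsP; exists (v, v^-1 * g).
split=> /=; [|by rewrite mem_wball|by rewrite mulVKg].
by apply: reach => //; apply: leq_trans Nn; apply: V_norm.
Qed.
End Net.

(** * Heads, tracks and gates *)

Section Heads.
Context (G : groupType) (A : finType) (S : set G).
Hypothesis genS : generated S = [set: G].
Hypothesis finS : finite_set S.
Context (a0 a1 : A).
Hypothesis a01 : a0 != a1.
Context (delta : nat) (p0 : G).
Hypothesis p0_norm : wnorm S p0 = (3 * delta + 7)%N.
Context (nb : nat).
Hypothesis leq_cells : (6 + nb <= size (wball S delta))%N.

Local Notation X := (config G A).
Local Notation nrm := (wnorm S).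
Local Notation rad := (5 * delta + 11)%N.

Definition is_bit (a : A) : bool := (a == a0) || (a == a1).

(* A head stores bits in the ball of radius [delta], surrounded by a ring of
   [a1] of width two, then by [a0] up to radius [rad] except for one [a1] at
   [p0], which breaks the symmetry of the ball. *)
Definition cell_ok (g : G) (a : A) : bool :=
  if (nrm g <= delta)%N then is_bit a
  else if (nrm g <= delta.+2)%N || (g == p0) then a == a1 else a == a0.

Definition head (x : X) (u : G) : bool :=
  all (fun g => cell_ok g (x (u * g))) (wball S rad).

Lemma headP x u :
  reflect (forall g, (nrm g <= rad)%N -> cell_ok g (x (u * g))) (head x u).
Proof.
apply: (iffP allP) => hx g; first by move=> gr; apply: hx; rewrite mem_wball.
by rewrite mem_wball // => /hx.
Qed.

(* Far apart, the inner ring of the second head meets the zeros of the first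
   one; nearby, the marker [p0] of the second head does. *)
Lemma head_separated x u k :
  head x u -> head x (u * k) -> k != 1 -> (rad + delta < nrm k)%N.
Proof.
move=> /headP hu /headP huk k1; rewrite ltnNge; apply/negP => k_le.
(* For small [k], the norm of [k * p0] lies between [delta + 3] and [5 * delta + 11], so the first
   head requires [a0] there, while it is the marker cell of the second head. This explains the
   values [3 * delta + 7] and [rad]. *)
have [k_small|k_large] := leqP (nrm k) (2 * delta + 4).
  have n1 := wnormM genS k p0; have n2 := wnormM genS k^-1 (k * p0).
  rewrite mulKg wnormV // in n2.
  have /huk : (nrm p0 <= rad)%N by lia.
  have /hu : (nrm (k * p0) <= rad)%N by lia.
  have kp : k * p0 != p0.
    by apply: contraNneq k1 => kp; apply/eqP/(mulIg p0); rewrite mul1g.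
  rewrite /cell_ok mulgA eqxx orbT (negPf kp) orbF.
  rewrite (_ : (nrm (k * p0) <= delta)%N = false); last by lia.
  rewrite (_ : (nrm (k * p0) <= delta.+2)%N = false); last by lia.
  rewrite (_ : (nrm p0 <= delta)%N = false); last by lia.
  by move=> /eqP ->; rewrite (negPf a01).
(* The cell at distance [i] before the end of a geodesic for [k] lies in the ring of the second
   head, so for the first head it can only be the marker. This would fix the norm of [k],
   differently for the two values of [i]: hence the width two of the ring. *)
have ring i : (delta < i <= delta.+2)%N -> nrm k = (i + nrm p0)%N.
  move=> /andP[i1 i2].
  have [|h [m [hn mn kE]]] := @wnorm_split _ _ genS k (nrm k - i); first by lia.
  have /huk : (nrm m^-1 <= rad)%N by rewrite wnormV //; lia.
  have /hu : (nrm h <= rad)%N by lia.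
  have [hp|hp] := eqVneq h p0; first by rewrite -hp; lia.
  rewrite /cell_ok wnormV // kE -!mulgA mulgV mulg1 (negPf hp) orbF.
  rewrite (_ : (nrm h <= delta)%N = false); last by lia.
  rewrite (_ : (nrm h <= delta.+2)%N = false); last by lia.
  rewrite (_ : (nrm m <= delta)%N = false); last by lia.
  rewrite (_ : (nrm m <= delta.+2)%N = true); last by lia.
  by move=> /eqP ->; rewrite (negPf a01).
by have := ring delta.+1; have := ring delta.+2; lia.
Qed.

Definition cell (i : nat) : G := nth 1 (wball S delta) i.
Definition track_cell (j : 'I_6) : G := cell j.
Definition static_cell (i : 'I_nb) : G := cell (6 + i).

Lemma cell_norm i : (i < 6 + nb)%N -> (nrm (cell i) <= delta)%N.
Proof.
by move=> lti; rewrite -mem_wball // mem_nth // (leq_trans lti).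
Qed.

Lemma cell_inj i j : (i < 6 + nb)%N -> (j < 6 + nb)%N -> cell i = cell j -> i = j.
Proof.
move=> lti ltj /eqP; rewrite nth_uniq ?uniq_wball ?(leq_trans _ leq_cells) //.
by move/eqP.
Qed.

Lemma track_cell_norm j : (nrm (track_cell j) <= delta)%N.
Proof. by apply: cell_norm; rewrite (leq_trans (ltn_ord j)) ?leq_addr. Qed.

Lemma static_cell_norm i : (nrm (static_cell i) <= delta)%N.
Proof. by apply: cell_norm; rewrite ltn_add2l. Qed.

Lemma track_cell_inj : injective track_cell.
Proof.
by move=> i j /cell_inj ij; apply/val_inj/ij;
  rewrite (leq_trans (ltn_ord _)) ?leq_addr.
Qed.

Lemma track_static_cell i j : track_cell i != static_cell j.
Proof.
apply/eqP => /cell_inj; have := ltn_ord i; have := ltn_ord j; lia.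
Qed.

Definition swap_bit (a : A) : A :=
  if a == a0 then a1 else if a == a1 then a0 else a.

Lemma swap_bitK : involutive swap_bit.
Proof.
move=> a; rewrite /swap_bit; have [->|a_0] := eqVneq a a0.
  by rewrite eq_sym (negPf a01) eqxx.
by have [->|a_1] := eqVneq a a1; rewrite ?eqxx // (negPf a_0) (negPf a_1).
Qed.

Lemma is_bit_swap a : is_bit (swap_bit a) = is_bit a.
Proof.
rewrite /is_bit /swap_bit; have [->|a_0] := eqVneq a a0.
  by rewrite eqxx orbT.
by have [_|a_1] := eqVneq a a1; rewrite ?eqxx // (negPf a_0) (negPf a_1).
Qed.

Lemma swap_bit1 a : is_bit a -> (swap_bit a == a1) = ~~ (a == a1).
Proof.
have a10 : (a1 == a0) = false by rewrite eq_sym (negPf a01).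
by rewrite /swap_bit => /orP[] /eqP ->; rewrite !eqxx ?a10 ?eqxx ?(negPf a01).
Qed.

(** The condition [phi] is a predicate on positions, not on configurations, so that compositions can
    be computed with the condition frozen. *)
Definition flip (j : 'I_6) (phi : G -> bool) (x : X) : X := fun c =>
  let v := c * (track_cell j)^-1 in
  if head x v && phi v then swap_bit (x c) else x c.

Definition read (j : 'I_6) (x : X) (u : G) : bool := x (u * track_cell j) == a1.

Definition statics (x : X) (u : G) : {ffun 'I_nb -> bool} :=
  [ffun i => x (u * static_cell i) == a1].

(** A flipped cell in this range that belongs to another head would put the two heads within
    distance [rad + delta]. *)
Lemma flip_far j phi x u g :
    head x u -> (nrm g <= rad)%N -> g != track_cell j ->
  flip j phi x (u * g) = x (u * g).
Proof.
move=> hu gr gj; rewrite /flip; case: ifP => // /andP[hv _]; exfalso.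
have : (rad + delta < nrm (g * (track_cell j)^-1))%N.
  apply: (head_separated hu); first by rewrite mulgA.
  by apply: contra gj => /eqP gj; apply/eqP/(mulIg (track_cell j)^-1); rewrite gj mulgV.
have := wnormM genS g (track_cell j)^-1; rewrite wnormV //.
by have := track_cell_norm j; lia.
Qed.

Lemma flip_track j phi x u : head x u ->
  flip j phi x (u * track_cell j) =
  if phi u then swap_bit (x (u * track_cell j)) else x (u * track_cell j).
Proof. by move=> hu; rewrite /flip mulgK hu. Qed.

Lemma cell_ok_track j a : cell_ok (track_cell j) a = is_bit a.
Proof. by rewrite /cell_ok track_cell_norm. Qed.

Lemma read_bit j x u : head x u -> is_bit (x (u * track_cell j)).
Proof.
move=> /headP hu; rewrite -(cell_ok_track j) hu //.
by have := track_cell_norm j; lia.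
Qed.

Lemma head_flip_sub j phi x u : head x u -> head (flip j phi x) u.
Proof.
move=> hu; have /headP hu' := hu; apply/headP => g gr.
have [->|gj] := eqVneq g (track_cell j); last by rewrite flip_far // hu'.
rewrite cell_ok_track flip_track //; case: ifP => _.
  by rewrite is_bit_swap read_bit.
exact: read_bit.
Qed.

(** No head is created either: a new head would contain a flipped cell of an old one, and the old
    one is still a head after the flip, so separation applies in the flipped configuration. *)
Lemma head_flip j phi x : head (flip j phi x) = head x.
Proof.
apply/funext => u; apply/idP/idP; last exact: head_flip_sub.
move=> hu; apply: contraT => nhu; have /headP hu' := hu.
suff: head x u by rewrite (negPf nhu).
apply/headP => g gr; have := hu' g gr; rewrite {1}/flip.
case: ifP => // /andP[hv _].
have [gj|gj] := eqVneq g (track_cell j).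
  by move: hv; rewrite gj mulgK (negPf nhu).
have : (rad + delta < nrm (g * (track_cell j)^-1))%N.
  apply: (head_separated hu); first by rewrite mulgA head_flip_sub.
  by apply: contra gj => /eqP gj; apply/eqP/(mulIg (track_cell j)^-1); rewrite gj mulgV.
have := wnormM genS g (track_cell j)^-1; rewrite wnormV //.
by have := track_cell_norm j; lia.
Qed.

Lemma read_flip i j phi x u : head x u ->
  read i (flip j phi x) u = read i x u (+) ((i == j) && phi u).
Proof.
move=> hu; rewrite /read; have [->|ij] := eqVneq i j.
  rewrite flip_track //; case: (phi u); rewrite ?addbF // addbT.
  by rewrite swap_bit1 // read_bit.
rewrite flip_far ?addbF //; first by have := track_cell_norm i; lia.
by rewrite (inj_eq track_cell_inj).
Qed.

Lemma statics_flip j phi x u : head x u -> statics (flip j phi x) u = statics x u.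
Proof.
move=> hu; apply/ffunP => i; rewrite !ffunE flip_far //.
  by have := static_cell_norm i; lia.
by rewrite eq_sym track_static_cell.
Qed.

Lemma eq_flip j phi psi x : (forall u, head x u -> phi u = psi u) ->
  flip j phi x = flip j psi x.
Proof.
move=> E; apply/funext => c; rewrite /flip.
by case hv: (head x _) => //=; rewrite E.
Qed.

Lemma flip_false j x : flip j (fun=> false) x = x.
Proof. by apply/funext => c; rewrite /flip andbF. Qed.

Lemma flipD j phi psi x :
  flip j phi (flip j psi x) = flip j (fun u => phi u (+) psi u) x.
Proof.
apply/funext => c; rewrite {1}/flip head_flip.
rewrite /flip; case: (head x _) => //=.
by case: (phi _); case: (psi _) => //=; rewrite swap_bitK.
Qed.

Lemma flipC i j phi psi x :
  flip i phi (flip j psi x) = flip j psi (flip i phi x).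
Proof.
apply/funext => c; rewrite {1 3}/flip !head_flip /flip.
by case: (head x _ && _); case: (head x _ && _).
Qed.

(** * Local observables, gates and their commutators *)

Context (I : finType) (hop : I -> G).

Definition neighbor (o : option (I * bool)) : G :=
  if o is Some (i, back) then if back then (hop i)^-1 else hop i else 1.

Local Notation view :=
  {ffun option (I * bool) -> bool * {ffun 'I_nb -> bool} * {ffun 'I_6 -> bool}}.

Definition look (x : X) (u : G) : view :=
  [ffun o => (head x (u * neighbor o), statics x (u * neighbor o),
              [ffun j => read j x (u * neighbor o)])].

Lemma translateE g (x : X) u h : translate g x (g * u * h) = x (u * h).
Proof. by rewrite /translate -mulgA mulKg. Qed.

Lemma head_translate g x u : head (translate g x) (g * u) = head x u.
Proof. by rewrite /head; apply: eq_all => h; rewrite translateE. Qed.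

Lemma statics_translate g x u : statics (translate g x) (g * u) = statics x u.
Proof. by apply/ffunP => i; rewrite !ffunE translateE. Qed.

Lemma look_translate g x u : look (translate g x) (g * u) = look x u.
Proof.
apply/ffunP => o; rewrite !ffunE -mulgA head_translate statics_translate.
by congr (_, _, _); apply/ffunP => j; rewrite !ffunE /read translateE.
Qed.

Lemma look_window :
  exists W : seq G, forall x y : X, {in W, x =1 y} -> look x 1 = look y 1.
Proof.
exists [seq neighbor o * g | o <- enum {: option (I * bool)}, g <- wball S rad].
move=> x y xy; apply/ffunP => o; rewrite !ffunE mul1g.
have {}xy g : (nrm g <= rad)%N -> x (neighbor o * g) = y (neighbor o * g).
  move=> gr; apply/xy/allpairsP; exists (o, g).
  by rewrite /= mem_enum mem_wball.
congr (_, _, _).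
- by apply: eq_in_all => g; rewrite mem_wball // => gr; rewrite xy.
- apply/ffunP => i; rewrite !ffunE xy //; have := static_cell_norm i; lia.
- apply/ffunP => j; rewrite !ffunE /read xy //; have := track_cell_norm j; lia.
Qed.

Lemma head_window u :
  exists W : seq G, forall x y : X, {in W, x =1 y} -> head x u = head y u.
Proof.
exists [seq u * g | g <- wball S rad] => x y xy.
by apply: eq_in_all => g gr; rewrite xy // map_f.
Qed.

Definition observable : Type := X -> G -> bool.

Definition is_gate (F : observable) : Prop :=
  exists P : view -> bool, forall x u, F x u = P (look x u).

Definition insensitive (j : 'I_6) (F : observable) : Prop :=
  forall phi x u, head x u -> F (flip j phi x) u = F x u.

Definition add (j : 'I_6) (F : observable) (x : X) : X := flip j (F x) x.

Lemma add_involutive j F : insensitive j F -> involutive (add j F).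
Proof.
move=> jF x; rewrite /add flipD -[RHS](flip_false j); apply: eq_flip => u hu.
by rewrite jF // addbb.
Qed.

Lemma add_gate_shift_aut j F : is_gate F -> insensitive j F ->
  homeomorphism (add j F) /\ equivariant (add j F).
Proof.
move=> [P FE] jF; split.
  suff cont : continuous (add j F).
    by exists (add j F); split=> //; apply: add_involutive.
  apply/continuous_configP => x c.
  pose v := c * (track_cell j)^-1.
  have [W1 W1P] := head_window v; have [W2 W2P] := look_window.
  exists (c :: W1 ++ [seq v * g | g <- W2]) => y yW.
  have yc : y c = x c by apply: yW; rewrite mem_head.
  have hv : head y v = head x v.
    by apply: W1P => g gW; apply: yW; rewrite inE mem_cat gW orbT.
  have lv : look y v = look x v.
    rewrite -(mulg1 v) -(look_translate v^-1 y) -(look_translate v^-1 x).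
    rewrite mulKg; apply: W2P => g gW; rewrite /translate invgK; apply: yW.
    by rewrite inE mem_cat map_f ?orbT.
  by rewrite /add /flip -/v hv !FE lv yc.
move=> g x; apply/funext => c; rewrite /add /flip [RHS]/translate.
set v := c * _; have vE : v = g * (g^-1 * v) by rewrite mulVKg.
have -> : g^-1 * c * (track_cell j)^-1 = g^-1 * v by rewrite /v mulgA.
by rewrite vE head_translate !FE look_translate -vE.
Qed.

Definition gates : set (shift_aut G A) :=
  [set f | exists j F, [/\ is_gate F, insensitive j F & f = add j F :> (X -> X)]].

(** A gate is given by a track and a Boolean function on the finite type of views; pairs that yield
    no automorphism are sent to the unit by [insubd]. *)
Lemma finite_gates : finite_set gates.
Proof.
pose g (jP : 'I_6 * {ffun view -> bool}) : shift_aut G A :=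
  insubd (aut_one G A) (add jP.1 (fun x u => jP.2 (look x u)) : X -> X).
apply: (@sub_finite_set _ _ (g @` setT)); last exact: finite_image.
move=> f [j [F [[P FE] jF fE]]]; exists (j, finfun P) => //.
apply: val_inj; rewrite /g /= fE.
have <- : F = (fun x u => [ffun l => P l] (look x u)).
  by apply/funext => x; apply/funext => u; rewrite ffunE FE.
rewrite insubdK //; apply/asboolP; apply: add_gate_shift_aut => //.
by exists P.
Qed.

Local Notation word_length := (word_length gates).

Lemma gatesV f : gates f -> gates f^-1.
Proof.
move=> gf; suff -> : f^-1 = f by [].
have [j [F [_ jF fE]]] := gf; apply: (mulgI f); rewrite mulgV; apply: val_inj.
by apply/funext => x; rewrite /= fE add_involutive.
Qed.

Definition addable (j : 'I_6) (F : observable) (n : nat) : Prop :=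
  insensitive j F /\
  exists k f, [/\ (k <= n)%N, word_length k f & f = add j F :> (X -> X)].

Lemma leq_addable j F m n : (m <= n)%N -> addable j F m -> addable j F n.
Proof.
by move=> mn [jF [k [f [km kf fE]]]]; split=> //; exists k, f; rewrite (leq_trans km).
Qed.

Lemma eq_addable j F F' n :
  (forall x u, head x u -> F x u = F' x u) -> addable j F n -> addable j F' n.
Proof.
move=> E [jF [k [f [kn kf fE]]]]; split.
  by move=> phi x u hu; rewrite -!E ?head_flip // jF.
exists k, f; split=> //; rewrite fE; apply/funext => x; exact/eq_flip/E.
Qed.

Lemma addable_gate j F : is_gate F -> insensitive j F -> addable j F 1.
Proof.
move=> gF jF; split=> //.
pose f := ShiftAut (introT (asboolP _) (add_gate_shift_aut gF jF)).
by exists 1%N, f; split=> //; constructor; exists j, F.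
Qed.

Lemma addable_xor j F F' m n : addable j F m -> addable j F' n ->
  addable j (fun x u => F x u (+) F' x u) (m + n).
Proof.
move=> [jF [k [f [km kf fE]]]] [jF' [k' [f' [kn kf' fE']]]]; split.
  by move=> phi x u hu; rewrite jF ?jF'.
exists (k + k')%N, (f * f'); split; [exact: leq_add|by constructor|].
apply/funext => x /=; rewrite fE fE' /add flipD.
by apply: eq_flip => u hu; rewrite jF.
Qed.

Lemma addable_commutator i j F E m n : i != j -> insensitive j E ->
  addable j F m -> addable i E n ->
  addable j (fun x u => F x u (+) F (add i E x) u) (2 * m + 2 * n).
Proof.
move=> ij jE [jF [k [f [km kf fE]]]] [iE [l [g [ln lg gE]]]]; split.
  move=> phi x u hu; rewrite jF //; congr (_ (+) _).
  have -> : add i E (flip j phi x) = flip j phi (add i E x).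
    by rewrite /add flipC; congr (flip _ _ _); apply: eq_flip => v; apply: jE.
  by rewrite jF // /add head_flip.
exists ((k + l) + (k + l))%N, ((f * g) * (f * g)); split; [lia|by do 2!constructor|].
apply/funext => x /=; rewrite fE gE; set y := add i E x.
have yK : add i E y = x by rewrite /y add_involutive.
have -> : add i E (add j F y) = flip j (F y) x.
  rewrite -[in RHS]yK /add [RHS]flipC; apply: eq_flip => u; rewrite /= head_flip => hu.
  by rewrite jE.
by rewrite /add flipD; apply: eq_flip => u hu; rewrite jF.
Qed.

Lemma addable_conj j F (f : shift_aut G A) m n :
    word_length m f -> (forall x, head (f x) = head x) ->
    (forall phi x, f (flip j phi x) = flip j phi (f x)) ->
  addable j F n -> addable j (fun x => F (f x)) (n + 2 * m).
Proof.
move=> mf hf ff [jF [k [g [kn kg gE]]]]; split.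
  by move=> phi x u hu; rewrite ff jF // hf.
exists (m + (k + m))%N, (f^-1 * (g * f)); split; first lia.
  by constructor; [exact: word_lengthV gatesV mf|constructor].
apply/funext => x /=; rewrite gE /add.
have fK y : aut_fun (f^-1)%g (f y) = y.
  by rewrite -[LHS]/(aut_fun (f^-1 * f)%g y) mulVg.
by rewrite -[LHS]/(aut_fun (f^-1)%g _) -ff fK.
Qed.

(** The commutator trick of Barrington: start from the gate that adds [read p && read q], replace
    [read p] by [F] with one commutator, then [read q] by [E] with another. The contents of the
    scratch tracks [p] and [q] cancel. *)
Lemma addable_and j p q F E m n : uniq [:: j; p; q] ->
    insensitive j F -> insensitive q F -> insensitive j E ->
    addable p F m -> addable q E n ->
  addable j (fun x u => F x u && E x u) (4 + 4 * m + 2 * n).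
Proof.
move=> /= /and3P[]; rewrite !inE negb_or => /andP[jp jq] pq _ jF qF jE pF qE.
have rI i k : i != k -> insensitive k (read i).
  by move=> ik phi x u hu; rewrite read_flip // (negPf ik) addbF.
have t1 : addable j (fun x u => read p x u && read q x u) 1.
  apply: addable_gate.
    exists (fun l : view => (l None).2 p && (l None).2 q) => x u.
    by rewrite !ffunE /= mulg1.
  by move=> phi x u hu; rewrite !rI // eq_sym.
have pj : p != j by rewrite eq_sym.
have qj : q != j by rewrite eq_sym.
have t2 : addable j (fun x u => F x u && read q x u) (2 + 2 * m).
  apply: eq_addable (addable_commutator pj jF t1 pF) => x u hu.
  rewrite /= /add !read_flip // eqxx (eq_sym q) (negPf pq) addbF /=.
  by case: (F x u); case: (read p x u); case: (read q x u).
apply: leq_addable (eq_addable _ (addable_commutator qj jE t2 qE)) => [|x u hu].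
  lia.
rewrite /= /add qF // read_flip // eqxx /=.
by case: (F x u); case: (E x u); case: (read q x u).
Qed.

(** * Partial maps between heads and the shears along them *)

Definition pmap : Type := X -> G -> option G.

Definition static (f : pmap) : Prop := forall x u, head x u ->
  (forall v, f x u = Some v -> head x v) /\
  forall j phi, f (flip j phi x) u = f x u.

Definition pcomp (g f : pmap) : pmap := fun x u => obind (g x) (f x u).

Definition pull (i : 'I_6) (f : pmap) : observable := fun x u =>
  if f x u is Some v then read i x v else false.

Lemma static_comp g f : static g -> static f -> static (pcomp g f).
Proof.
move=> sg sf x u hu; rewrite /pcomp; have [fv fflip] := sf x u hu; split.
  move=> w; case: (f x u) fv => [v|//] /(_ v erefl) hv /=.
  exact: (sg x v hv).1.
move=> j phi; rewrite fflip; case: (f x u) fv => [v|//] /(_ v erefl) hv /=.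
exact: (sg x v hv).2.
Qed.

Lemma insensitive_pull j i f : i != j -> static f -> insensitive j (pull i f).
Proof.
move=> ij sf phi x u hu; rewrite /pull; have [fv ->] := sf x u hu.
case: (f x u) fv => [v|//] /(_ v erefl) hv.
by rewrite read_flip // (negPf ij) addbF.
Qed.

Lemma pull_flip i f phi x u : static f -> head x u ->
  pull i f (flip i phi x) u =
  pull i f x u (+) (if f x u is Some v then phi v else false).
Proof.
move=> sf hu; rewrite /pull; have [fv ->] := sf x u hu.
by case: (f x u) fv => [v|//] /(_ v erefl) hv; rewrite read_flip // eqxx.
Qed.

Definition shear (f : pmap) (n : nat) : Prop :=
  forall i j, i != j -> addable j (pull i f) n.

Lemma third_track (i j : 'I_6) : exists k, (k != i) && (k != j).
Proof.
have : 0 < #|~: [set i; j]%SET|.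
  have := cardsC [set i; j]%SET; rewrite card_ord cards2; case: eqP; lia.
by case/card_gt0P => k; rewrite !inE negb_or => kP; exists k.
Qed.

(** This is the commutator relation of elementary matrices: adding track [k] at [f] to track [j],
    and track [i] at [g] to track [k], yields track [i] at the composite. *)
Lemma shear_comp g f m n : static g -> static f -> shear f m -> shear g n ->
  shear (pcomp g f) (2 * m + 2 * n).
Proof.
move=> sg sf fm gn i j ij; have [k /andP[ki kj]] := third_track i j.
have kg := gn i k; rewrite eq_sym in kg.
apply: eq_addable (addable_commutator kj (insensitive_pull ij sg) (fm _ _ kj) (kg ki)).
move=> x u hu; rewrite /= pull_flip // addbA addbb /pull /pcomp.
by case: (f x u).
Qed.

Fixpoint psquare (k : nat) (f : pmap) : pmap :=
  if k is k'.+1 then pcomp (psquare k' f) (psquare k' f) else f.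

Lemma psquareE k f x u : psquare k f x u = iter (2 ^ k) (obind (f x)) (Some u).
Proof.
elim: k u => [//|k IH] u; rewrite /= /pcomp IH expnS mul2n -addnn iterD.
case: (iter _ _ (Some u)) => [v|] /=; first by rewrite IH.
by elim: (2 ^ k)%N => //= n <-.
Qed.

Lemma static_square k f : static f -> static (psquare k f).
Proof. by move=> sf; elim: k => //= k IH; apply: static_comp. Qed.

(** Each squaring multiplies the cost by four, so the cost is only quadratic in the number [2 ^ k]
    of iterations. *)
Lemma shear_square k f n : static f -> shear f n -> shear (psquare k f) (4 ^ k * n).
Proof.
move=> sf fn; elim: k => [|k IH]; first by rewrite mul1n.
rewrite expnS -mulnA; set m := (4 ^ k * n)%N in IH *.
have -> : (4 * m = 2 * m + 2 * m)%N by lia.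
by apply: shear_comp => //; apply: static_square.
Qed.

(** * Trees of heads drawn by static pointers *)

Context (br : {ffun 'I_nb -> bool} -> bool).
Context (ch : {ffun 'I_nb -> bool} -> 'I_3 -> option I).
Context (par : {ffun 'I_nb -> bool} -> option (I * 'I_3)).

(* The edge [e] below [u] counts only if both ends agree on it; this makes
   [down e] injective and the images of distinct edges disjoint. *)
Definition down (e : 'I_3) : pmap := fun x u =>
  if ch (statics x u) e is Some i then
    if head x (u * hop i) && (par (statics x (u * hop i)) == Some (i, e))
    then Some (u * hop i) else None
  else None.

Definition up (e : 'I_3) : pmap := fun x v =>
  if par (statics x v) is Some (i, e') then
    if [&& e' == e, head x (v * (hop i)^-1) &
           ch (statics x (v * (hop i)^-1)) e == Some i]
    then Some (v * (hop i)^-1) else None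
  else None.

(* Binary nodes are fixed, so that iterating follows a subdivided edge up to
   its end; likewise [up_unary] stops below the next binary node. *)
Definition down_unary : pmap := fun x u =>
  if br (statics x u) then Some u else down ord0 x u.

Definition up_unary : pmap := fun x v =>
  if par (statics x v) is Some (_, e) then
    if e == ord0 then up ord0 x v else Some v
  else Some v.

Lemma downP e x u v : head x u -> down e x u = Some v ->
  [/\ head x v, up e x v = Some u &
      exists i, par (statics x v) = Some (i, e)].
Proof.
rewrite /down => hu; case chE: (ch _ e) => [i|//].
case: ifP => // /andP[hv /eqP parE] [<-]; split=> //; last by exists i.
by rewrite /up parE eqxx mulgK hu chE eqxx.
Qed.

Lemma static_down e : static (down e).
Proof.
move=> x u hu; split=> [v /(downP hu)[]//|j phi].
rewrite /down statics_flip //; case: (ch _ e) => [i|//].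
rewrite head_flip; case hv: (head x _) => //=.
by rewrite statics_flip.
Qed.

Lemma static_up e : static (up e).
Proof.
move=> x u hu; split=> [v|j phi].
  by rewrite /up; case: (par _) => [[i e']|//]; case: ifP => // /and3P[_ hv _] [<-].
rewrite /up statics_flip //; case: (par _) => [[i e']|//].
rewrite head_flip; case hv: (head x _) => //=.
by rewrite statics_flip.
Qed.

Lemma static_down_unary : static down_unary.
Proof.
move=> x u hu; have [dv dflip] := static_down ord0 hu.
rewrite /down_unary; split=> [v|j phi].
  by case: ifP => [_ [<-]//|_]; apply: dv.
by rewrite statics_flip // dflip.
Qed.

Lemma static_up_unary : static up_unary.
Proof.
move=> x u hu; have [dv dflip] := static_up ord0 hu.
rewrite /up_unary; split=> [v|j phi].
  case: (par _) => [[i e]|[<-]//].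
  by case: ifP => [_|_ [<-]//]; apply: dv.
by rewrite statics_flip // dflip.
Qed.

Lemma lookE x u o : look x u o = (head x (u * neighbor o),
  statics x (u * neighbor o), [ffun j => read j x (u * neighbor o)]).
Proof. by rewrite ffunE. Qed.

Lemma shear_gate f : static f ->
    (forall i, is_gate (pull i f)) -> shear f 1.
Proof.
by move=> sf gf i j ij; apply: addable_gate => //; apply: insensitive_pull.
Qed.

Definition look_down (e : 'I_3) (i : 'I_6) (l : view) : bool :=
  if ch (l None).1.2 e is Some k then
    let m := l (Some (k, false)) in
    [&& m.1.1, par m.1.2 == Some (k, e) & m.2 i]
  else false.

Definition look_up (e : 'I_3) (i : 'I_6) (l : view) : bool :=
  if par (l None).1.2 is Some (k, e') then
    let m := l (Some (k, true)) in
    [&& e' == e, m.1.1, ch m.1.2 e == Some k & m.2 i]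
  else false.

Lemma pull_downE e i x u : pull i (down e) x u = look_down e i (look x u).
Proof.
rewrite /pull /down /look_down lookE /= mulg1; case: (ch _ e) => [k|//].
by rewrite lookE /= ffunE andbA; case: ifP.
Qed.

Lemma pull_upE e i x u : pull i (up e) x u = look_up e i (look x u).
Proof.
rewrite /pull /up /look_up lookE /= mulg1; case: (par _) => [[k e']|//].
by rewrite lookE /= ffunE !andbA; case: ifP.
Qed.

Lemma shear_down e : shear (down e) 1.
Proof.
apply: (shear_gate (static_down e)) => i.
by exists (look_down e i) => x u; apply: pull_downE.
Qed.

Lemma shear_up e : shear (up e) 1.
Proof.
apply: (shear_gate (static_up e)) => i.
by exists (look_up e i) => x u; apply: pull_upE.
Qed.

Lemma shear_down_unary : shear down_unary 1.
Proof.
apply: (shear_gate static_down_unary) => i.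
exists (fun l : view => if br (l None).1.2 then (l None).2 i else look_down ord0 i l).
move=> x u; rewrite -pull_downE /pull /down_unary lookE /= mulg1 ffunE.
by case: (br _).
Qed.

Lemma shear_up_unary : shear up_unary 1.
Proof.
apply: (shear_gate static_up_unary) => i.
exists (fun l : view => if par (l None).1.2 is Some (_, e) then
  if e == ord0 then look_up ord0 i l else (l None).2 i else (l None).2 i).
move=> x u; rewrite -pull_upE /pull /up_unary lookE /= mulg1 ffunE.
by case: (par _) => [[k e]|//]; case: ifP.
Qed.

Context (K : nat).

Definition next (e : 'I_3) : pmap := pcomp (psquare K down_unary) (down e).
Definition prev (e : 'I_3) : pmap := pcomp (up e) (psquare K up_unary).

Lemma static_next e : static (next e).
Proof.
exact: static_comp (static_square _ static_down_unary) (static_down e).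
Qed.

Lemma static_prev e : static (prev e).
Proof. exact: static_comp (static_up e) (static_square _ static_up_unary). Qed.

Lemma shear_next e : shear (next e) (2 + 2 * 4 ^ K).
Proof.
have := shear_comp (static_square K static_down_unary) (static_down e)
  (shear_down e) (shear_square K static_down_unary shear_down_unary).
by rewrite !muln1.
Qed.

Lemma shear_prev e : shear (prev e) (2 * 4 ^ K + 2).
Proof.
have := shear_comp (static_up e) (static_square K static_up_unary)
  (shear_square K static_up_unary shear_up_unary) (shear_up e).
by rewrite !muln1.
Qed.

(** The descent may stall at the binary node [w]. The ascent makes up for it by stalling at [v],
    whose parent pointer carries a label other than [ord0]. *)
Lemma climb x v n w i e : head x v -> par (statics x v) = Some (i, e) ->
    e != ord0 -> iter n (obind (down_unary x)) (Some v) = Some w ->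
  head x w /\ iter n (obind (up_unary x)) (Some w) = Some v.
Proof.
move=> hv parv e0; have uv : up_unary x v = Some v.
  by rewrite /up_unary parv (negPf e0).
elim: n w => [|n IH] w; first by move=> [<-].
rewrite iterS; case wE: (iter n _ _) => [w'|//] /=.
have [hw' upw'] := IH _ wE; rewrite {1}/down_unary; case: ifP => [_ [<-]|_].
  by rewrite upw' /= uv.
move=> /(downP hw')[hw upw [k park]]; split=> //.
by rewrite -iterS iterSr /= {2}/up_unary park eqxx upw.
Qed.

(** The first node on the path records [e] in its parent pointer: the ascent stops there, and
    leaving through any other edge fails. *)
Lemma next_prev e e' x u w : e != ord0 -> head x u -> next e x u = Some w ->
  head x w /\ prev e' x w = if e' == e then Some u else None.
Proof.
move=> e0 hu; rewrite /next /prev /pcomp !psquareE.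
case dE: (down e x u) => [v|//] /=; have [hv upv [i parv]] := downP hu dE.
rewrite psquareE => /(climb hv parv e0)[hw ->]; split=> //=.
have [->//|ne] := eqVneq e' e.
by rewrite /up parv eq_sym (negPf ne).
Qed.

(* [t0] and [t1] hold the second-order evolution, [t2] and [t3] are scratch
   tracks with arbitrary contents, [t4] is read at the leaves and [t5] is
   flipped at the root. *)
Definition t0 : 'I_6 := @Ordinal 6 0 isT.
Definition t1 : 'I_6 := @Ordinal 6 1 isT.
Definition t2 : 'I_6 := @Ordinal 6 2 isT.
Definition t3 : 'I_6 := @Ordinal 6 3 isT.
Definition t4 : 'I_6 := @Ordinal 6 4 isT.
Definition t5 : 'I_6 := @Ordinal 6 5 isT.

Definition side (b : bool) : 'I_3 := if b then @Ordinal 3 2 isT else @Ordinal 3 1 isT.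

(** The term [1 + chi(left) * chi(right)] of the second-order rule; a missing child counts as
    [0]. *)
Definition wire (i : 'I_6) : observable := fun x u =>
  ~~ (pull i (next (side false)) x u && pull i (next (side true)) x u).

(** A leapfrog scheme: [t1] is updated from [t0], then [t0] from the new [t1]. Each half step is an
    involution. *)
Definition evolve (x : X) : X := add t0 (wire t1) (add t1 (wire t0) x).

Local Notation wire_cost := (17 + 12 * 4 ^ K)%N.

Lemma insensitive_wire i j : i != j -> insensitive j (wire i).
Proof.
move=> ij phi x u hu.
by rewrite /wire !(insensitive_pull ij (static_next _)).
Qed.

(** The cost is that of the conjunction of two [next] shears through the scratch tracks, plus one
    gate for the negation. *)
Lemma addable_wire i j : uniq [:: i; j; t2; t3] -> addable j (wire i) wire_cost.
Proof.
rewrite /= !inE !negb_or => /andP[/and3P[ij i2 i3] /andP[/andP[j2 j3] _]].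
have jN e := insensitive_pull ij (static_next e).
have iN e := insensitive_pull i3 (static_next e).
have := @addable_and j t2 t3 _ _ _ _ _ (jN _) (iN _) (jN _)
  (shear_next (side false) i2) (shear_next (side true) i3).
rewrite /= !inE negb_or j2 j3 => /(_ isT) and2.
have tt : addable j (fun=> fun=> true) 1.
  by apply: addable_gate => //; exists (fun=> true).
apply: leq_addable (eq_addable _ (addable_xor and2 tt)) => [|x u hu].
  by lia.
by rewrite addbT.
Qed.

Lemma add_flip i j F phi x : insensitive j F ->
  add i F (flip j phi x) = flip j phi (add i F x).
Proof.
by move=> jF; rewrite /add [RHS]flipC; apply: eq_flip => u; rewrite head_flip => /jF.
Qed.

Lemma head_evolve t x : head (iter t evolve x) = head x.
Proof. by elim: t => //= t IH; rewrite /evolve /add !head_flip IH. Qed.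

Lemma evolve_flip t (j : 'I_6) phi x : (1 < j)%N ->
  iter t evolve (flip j phi x) = flip j phi (iter t evolve x).
Proof.
move=> j1; elim: t => //= t ->.
have wj (i : 'I_6) : (i < 2)%N -> insensitive j (wire i).
  move=> i2; apply: insensitive_wire; apply/eqP => ij.
  by move: i2; rewrite ij ltnNge j1.
by rewrite /evolve (@add_flip t1 j) ?(@add_flip t0 j) //; apply: wj.
Qed.

Lemma evolve_word t : exists n f,
  [/\ (n <= t * (2 * wire_cost))%N, word_length n f & f = iter t evolve :> (X -> X)].
Proof.
elim: t => [|t [n [f [nt nf fE]]]]; first by exists 0%N, 1; split=> //; constructor.
have [_ [k1 [f1 [kc1 kf1 fE1]]]] := @addable_wire t0 t1 isT.
have [_ [k2 [f2 [kc2 kf2 fE2]]]] := @addable_wire t1 t0 isT.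
exists (k2 + k1 + n)%N, (f2 * f1 * f); split; first lia.
  by apply: WordLengthM => //; apply: WordLengthM.
by apply/funext => x /=; rewrite fE fE1 fE2.
Qed.

Lemma static_evolve f t x u : static f -> head x u -> f (iter t evolve x) u = f x u.
Proof.
move=> sf hu; elim: t => //= t <-; set y := iter t evolve x.
have hy : head y u by rewrite head_evolve.
rewrite /evolve /add (sf _ _ _).2 ?head_flip //.
by rewrite (sf _ _ hy).2.
Qed.

(* After [i] steps of [evolve], the tracks [t1] and [t0] show the values of the
   second-order rule at times [2 * i] and [2 * i + 1]. *)
Definition chi (x : X) (k : nat) (u : G) : bool :=
  read (if odd k then t0 else t1) (iter k./2 evolve x) u.

Definition along (f : pmap) (x : X) (phi : G -> bool) (u : G) : bool :=
  if f x u is Some v then phi v else false.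

Lemma chiSS x k u : head x u -> chi x k.+2 u = chi x k u (+)
  ~~ (along (next (side false)) x (chi x k.+1) u &&
      along (next (side true)) x (chi x k.+1) u).
Proof.
move=> hu; rewrite /chi /= uphalf_half; set t := k./2; set y := iter t evolve x.
have hy : head y = head x by rewrite head_evolve.
have pullE i z e : next e z u = next e x u ->
    pull i (next e) z u = along (next e) x (read i z) u.
  by move=> nE; rewrite /pull /along nE.
have nE e : next e y u = next e x u by apply: static_evolve => //; apply: static_next.
case: (odd k) => /=.
  rewrite ?add1n /= -/y /evolve; set y1 := add t1 _ y.
  have hy1 : head y1 = head x by rewrite /y1 /add head_flip.
  rewrite {1}/add read_flip ?hy1 // eqxx /=; congr (_ (+) ~~ _).
    by rewrite /y1 /add read_flip ?hy // addbF.
  have n1E e : next e y1 u = next e x u.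
    by rewrite -nE; apply: (static_next e _).2; rewrite hy.
  (* The second half step reads [t1] at the children before it acts, but it leaves [t1] unchanged,
     so this is the value at time [k.+1]. *)
  rewrite !pullE //; have E e : along (next e) x (read t1 y1) u =
    along (next e) x (read t1 (add t0 (wire t1) y1)) u.
    rewrite /along; have [nh _] := static_next e hu; case: (next e x u) nh => [v|//].
    by move=> /(_ v erefl) hv; rewrite /add read_flip ?hy1 // addbF.
  by rewrite !E.
rewrite ?add0n -/y /evolve; set y1 := add t1 _ y.
have hy1 : head y1 = head x by rewrite /y1 /add head_flip.
rewrite {1}/add read_flip ?hy1 // addbF /y1 /add read_flip ?hy // eqxx /=.
by rewrite /wire !pullE.
Qed.

Definition observe (t : nat) : observable := fun x u =>
  read t0 (iter t evolve x) u && read t1 (iter t evolve x) u.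

(** Halving the range keeps the nesting of conjunctions at depth [k], hence the cost polynomial in
    [2 ^ k]. *)
Fixpoint observe_all (k t : nat) : observable :=
  if k is k'.+1 then
    fun x u => observe_all k' t x u && observe_all k' (t + 2 ^ k') x u
  else observe t.

Lemma observeE t x u : observe t x u = chi x t.*2 u && chi x t.*2.+1 u.
Proof. by rewrite /observe /chi /= odd_double /= uphalf_double doubleK andbC. Qed.

Lemma observe_allP k t x u : reflect
  (forall i, (t.*2 <= i < (t + 2 ^ k).*2)%N -> chi x i u) (observe_all k t x u).
Proof.
elim: k t => [|k IH] t /=.
  rewrite observeE expn0 addn1; apply: (iffP andP) => [[h0 h1] i|h].
    rewrite doubleS ltnS leq_eqVlt => /andP[/orP[/eqP <- //|]].
    by move=> ti; rewrite leq_eqVlt => /orP[/eqP -> //|]; lia.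
  by split; apply: h; lia.
apply: (iffP andP) => [[/IH h0 /IH h1] i|h].
  rewrite expnS => /andP[ti it]; case: (ltnP i (t + 2 ^ k).*2) => ik.
    by apply: h0; rewrite ti.
  by apply: h1; rewrite ik; lia.
by split; apply/IH => i ti; apply: h; rewrite expnS; lia.
Qed.

Lemma chi_flip (j : 'I_6) phi x k u : (1 < j)%N -> head x u ->
  chi (flip j phi x) k u = chi x k u.
Proof.
move=> j1 hu; rewrite /chi evolve_flip // read_flip ?head_evolve //.
have /negPf -> : (if odd k then t0 else t1) != j; last by rewrite addbF.
by apply/eqP => ij; move: j1; rewrite -ij; case: ifP.
Qed.

Lemma addable_observe t (j : 'I_6) : (1 < j)%N ->
  addable j (observe t) (1 + 4 * t * wire_cost).
Proof.
move=> j1; have [n [f [nt nf fE]]] := evolve_word t.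
have rj (i : 'I_6) : (i < 2)%N -> insensitive j (read i).
  move=> i2 phi x u hu; rewrite read_flip //.
  have /negPf -> : i != j by apply/eqP => ij; move: i2; rewrite ij ltnNge j1.
  by rewrite addbF.
have tj : addable j (fun x u => read t0 x u && read t1 x u) 1.
  apply: addable_gate.
    exists (fun l : view => (l None).2 t0 && (l None).2 t1) => x u.
    by rewrite lookE /= !ffunE /= mulg1.
  by move=> phi x u hu; rewrite !rj.
have := addable_conj (j := j) nf _ _ tj; rewrite fE => /(_ (head_evolve t)).
by move=> /(_ (fun phi x => evolve_flip t phi x j1)); apply: leq_addable; nia.
Qed.

(** The three tracks [t2], [t3], [t5] rotate as target and scratch. A conjunction of two terms of
    cost [a] costs [4 + 6 * a], whence the factor [10]; [M] makes the cost of a single observation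
    uniform. *)
Lemma addable_observe_all k t M j : (t + 2 ^ k <= M)%N -> j \in [:: t2; t3; t5] ->
  addable j (observe_all k t) (10 ^ k * (1 + 4 * M * wire_cost)).
Proof.
elim: k t j => [|k IH] t j tM jt.
  rewrite mul1n; apply: leq_addable (addable_observe t _).
    by rewrite leq_add2l leq_mul2r leq_mul2l; lia.
  by move: jt; rewrite !inE => /or3P[]/eqP->.
rewrite expnS in tM.
have {}IH i : i \in [:: t2; t3; t5] ->
    addable i (observe_all k t) (10 ^ k * (1 + 4 * M * wire_cost)) /\
    addable i (observe_all k (t + 2 ^ k)) (10 ^ k * (1 + 4 * M * wire_cost)).
  by move=> it; split; apply: IH => //; lia.
have [p [q [pt qt upq]]] : exists p q, [/\ p \in [:: t2; t3; t5],
    q \in [:: t2; t3; t5] & uniq [:: j; p; q]].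
  by move: jt; rewrite !inE => /or3P[]/eqP->;
    [exists t3, t5|exists t2, t5|exists t2, t3].
have := addable_and upq (IH _ jt).1.1 (IH _ qt).1.1 (IH _ jt).2.1
  (IH _ pt).1 (IH _ qt).2.
apply: leq_addable; rewrite expnS -mulnA; set a := (10 ^ k * _)%N.
have : (0 < a)%N by rewrite muln_gt0 expn_gt0.
lia.
Qed.

(** * Paths in the tree and the reach of the test *)

Fixpoint descend (w : seq bool) : pmap :=
  if w is b :: w' then pcomp (descend w') (next (side b)) else fun _ => Some.

Fixpoint ascend (w : seq bool) : pmap :=
  if w is b :: w' then pcomp (prev (side b)) (ascend w') else fun _ => Some.

Lemma static_descend w : static (descend w).
Proof.
elim: w => [|b w IH] /=; first by move=> x u hu; split=> [v [<-]|].
exact: static_comp IH (static_next _).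
Qed.

Lemma static_ascend w : static (ascend w).
Proof.
elim: w => [|b w IH] /=; first by move=> x u hu; split=> [v [<-]|].
exact: static_comp (static_prev _) IH.
Qed.

Lemma shear_id : shear (fun _ => Some) 1.
Proof.
apply: (shear_gate (static_descend [::])) => i.
by exists (fun l : view => (l None).2 i) => x u; rewrite lookE /= ffunE mulg1.
Qed.

Lemma shear_descend w : exists n, shear (descend w) n.
Proof.
elim: w => [|b w [n IH]] /=; first by exists 1%N; apply: shear_id.
by eexists; apply: shear_comp (static_descend w) (static_next _) (shear_next _) IH.
Qed.

Lemma shear_ascend w : exists n, shear (ascend w) n.
Proof.
elim: w => [|b w [n IH]] /=; first by exists 1%N; apply: shear_id.
by eexists; apply: shear_comp (static_prev _) (static_ascend w) IH (shear_prev _).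
Qed.

(** Ascending along a different word of the same length fails. This supplies the Kronecker delta in
    the commutation of [a] and [b]. *)
Lemma descend_ascend w w' x u v : head x u -> descend w x u = Some v ->
  size w = size w' ->
  head x v /\ ascend w' x v = if w' == w then Some u else None.
Proof.
elim: w w' u => [|b w IH] [|b' w'] u //= hu; first by move=> [<-].
rewrite /pcomp; case nE: (next _ x u) => [u'|//] /= dE [sw].
have sb : side b != ord0 by case: (b).
have [hu' _] := next_prev (side b) sb hu nE.
have [hv ->] := IH w' u' hu' dE sw; split=> //.
rewrite eqseq_cons; have [_|_] := eqVneq w' w; last by rewrite andbF.
rewrite /= (next_prev (side b') sb hu nE).2 andbT.
by case: (b); case: (b').
Qed.

(* Two equal values of [chi] at consecutive times of the same parity certify
   that both children exist and had value one in between. *)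
Lemma chi_descend w x u lo hi : head x u ->
    (forall k, (lo <= k <= hi)%N -> chi x k u) ->
    (lo + 2 * size w <= hi)%N ->
  exists v, descend w x u = Some v.
Proof.
elim: w u lo hi => [|b w IH] u lo hi hu cu /= le_hi; first by exists u.
have step k : (lo < k < hi)%N ->
    along (next (side false)) x (chi x k) u && along (next (side true)) x (chi x k) u.
  case: k => [|k]; first by rewrite ltn0.
  by move=> kP; have := chiSS k hu; rewrite !cu; lia.
have alongb k : (lo < k < hi)%N -> along (next (side b)) x (chi x k) u.
  by move=> /step/andP[]; case: (b).
rewrite /pcomp; have : (lo < lo.+1 < hi)%N by lia.
move=> /alongb; rewrite /along; case nE: (next _ x u) => [u'|//] _ /=.
have [hu' _] : head x u' /\ True by split=> //; apply: (static_next _ hu).1 nE.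
(* The child is known to read one only strictly inside the window, which shrinks by one at each end
   per level. *)
apply: (IH u' lo.+1 hi.-1) => // [k kP|]; last lia.
have /alongb : (lo < k < hi)%N by lia.
by rewrite /along nE.
Qed.

Lemma add_comm i j F E x : insensitive i E -> insensitive j F ->
  add i F (add j E x) = add j E (add i F x).
Proof.
move=> iE jF; rewrite /add.
have -> : flip i (F (flip j (E x) x)) (flip j (E x) x) = flip i (F x) (flip j (E x) x).
  by apply: eq_flip => u; rewrite head_flip => /jF.
by rewrite flipC; apply: eq_flip => u; rewrite head_flip => /iE ->.
Qed.

(** * The Heisenberg family indexed by leaves *)

Section Family.
Context (J : nat).
Local Notation depth := (2 ^ J).-1.
Local Notation word := (depth.-tuple bool).
Local Notation test := (observe_all J 0).

Lemma test_descend (w : word) x u : head x u -> test x u ->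
  exists v, descend w x u = Some v.
Proof.
(* The test covers the times from [0] to [2 * 2 ^ J - 1], and each of the [2 ^ J - 1] levels
   consumes two of them. *)
move=> hu /observe_allP tu; apply: (@chi_descend _ _ _ 0 (2 ^ J).*2.-1) => //.
  by move=> k kP; apply: tu; have := expn_gt0 2 J; lia.
by rewrite size_tuple; have := expn_gt0 2 J; lia.
Qed.

(** The condition asks the ancestor to exist and to read one on [t0]; a root that passes the test
    does so, because [t0] holds its value at time [1]. *)
Definition leaf_observable (w : word) : observable := pull t0 (ascend w).
Definition root_observable (w : word) : observable :=
  fun x u => test x u && pull t4 (descend w) x u.

Lemma addable_leaf w : exists n, addable t4 (leaf_observable w) n.
Proof. by have [n nw] := shear_ascend w; exists n; apply: nw. Qed.

Lemma addable_test j : j \in [:: t2; t3; t5] ->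
  addable j test (10 ^ J * (1 + 4 * 2 ^ J * wire_cost)).
Proof. by apply: addable_observe_all; rewrite add0n. Qed.

Lemma addable_root w : exists n, addable t5 (root_observable w) n.
Proof.
have [n nw] := shear_descend w; eexists.
apply: (@addable_and t5 t2 t3 test (pull t4 (descend w))) => //.
- by have [] := @addable_test t5 isT.
- by have [] := @addable_test t3 isT.
- exact: insensitive_pull (static_descend w).
- exact: addable_test.
- exact: nw.
Qed.

Lemma insensitive_test (j : 'I_6) : (1 < j)%N -> insensitive j test.
Proof.
move=> j1 phi x u hu.
by apply/observe_allP/observe_allP => h i /h; rewrite chi_flip.
Qed.

(** Flipping [t4] at the leaves changes the condition at a root exactly when the test passes there
    and the words agree: the leaf reached by [w'] ascends to that root along [w] only if
    [w = w']. *)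
Lemma leaf_root_commute (w w' : word) x :
  add t4 (leaf_observable w) (add t5 (root_observable w') x) =
  add t5 (root_observable w')
    (add t4 (leaf_observable w) (if w == w' then add t5 test x else x)).
Proof.
set P := leaf_observable w; set E := root_observable w'.
have P5 : insensitive t5 P by apply: insensitive_pull (static_ascend w).
have E5 : insensitive t5 E by have [n []] := addable_root w'.
have T5 : insensitive t5 test by apply: insensitive_test.
have T4 : insensitive t4 test by apply: insensitive_test.
have key u : head x u -> E (flip t4 (P x) x) u = E x u (+) ((w == w') && test x u).
  move=> hu; rewrite /E /root_observable T4 // pull_flip //; last exact: static_descend.
  case tu: (test x u) => /=; last by rewrite andbF.
  have [v dE] := test_descend w' hu tu; rewrite dE; congr (_ (+) _).
  have [|hv aE] := descend_ascend (w' := w) hu dE; first by rewrite !size_tuple.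
  rewrite /P /leaf_observable /pull aE -[(w : seq bool) == w']/(w == w').
  have [_|//] := eqVneq w w'; rewrite /=.
  by move/observe_allP: tu => /(_ 1%N); apply; have := expn_gt0 2 J; lia.
have lhsE : add t4 P (add t5 E x) = flip t5 (E x) (flip t4 (P x) x).
  by rewrite /add [RHS]flipC; apply: eq_flip => u; rewrite head_flip => /P5.
have rhsE : add t5 E (add t4 P x) =
    flip t5 (fun u => E x u (+) ((w == w') && test x u)) (flip t4 (P x) x).
  by rewrite /add; apply: eq_flip => u; rewrite head_flip => /key.
rewrite lhsE; case: eqP => ww; last first.
  rewrite rhsE; apply: eq_flip => u _.
  by case: eqP => //; rewrite addbF.
rewrite [add t5 test x]/add add_flip // add_flip //.
rewrite rhsE flipD; apply: eq_flip => u _; rewrite ww eqxx /=.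
by case: (E x u); case: (test x u).
Qed.
End Family.

Lemma addable_generated j F n : addable j F n ->
  exists f, generated gates f /\ f = add j F :> (X -> X).
Proof.
by move=> [_ [k [f [_ kf fE]]]]; exists f; split=> //; apply: word_length_generated kf.
Qed.

(** A length bound accompanies [z] alone, because the period of the torus will be chosen from the
    radius of its image. *)
Lemma exists_heisenberg_family (J : nat) :
  exists (z : shift_aut G A) (a b : (2 ^ J).-1.-tuple bool -> shift_aut G A) n,
    [/\ heisenberg_family z a b, (n <= 10 ^ J * (1 + 4 * 2 ^ J * wire_cost))%N /\ word_length n z,
        (forall w, generated gates (a w)), (forall w, generated gates (b w)) &
        forall x u, head x u -> observe_all J 0 x u -> z != 1].
Proof.
have [T5 [n [z [le_n nz zE]]]] := @addable_test J t5 isT.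
have /choice[a aP] : forall w : (2 ^ J).-1.-tuple bool, exists f,
    generated gates f /\ f = add t4 (leaf_observable w) :> (X -> X).
  by move=> w; have [m] := addable_leaf w; apply: addable_generated.
have /choice[b bP] : forall w : (2 ^ J).-1.-tuple bool, exists f,
    generated gates f /\ f = add t5 (root_observable w) :> (X -> X).
  by move=> w; have [m] := addable_root w; apply: addable_generated.
exists z, a, b, n; split=> //; [|by move=> w; have [] := aP w|by move=> w; have [] := bP w|].
  have zx x : z x = add t5 (observe_all J 0) x by rewrite zE.
  have ax w x : a w x = add t4 (leaf_observable w) x by rewrite (aP w).2.
  have bx w x : b w x = add t5 (root_observable w) x by rewrite (bP w).2.
  have L w j : t0 != j -> insensitive j (leaf_observable w).
    by move=> j0; apply: insensitive_pull (static_ascend w).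
  have R w : insensitive t5 (root_observable w) by have [m []] := addable_root w.
  have T (j : 'I_6) : (1 < j)%N -> insensitive j (observe_all J 0).
    exact: insensitive_test.
  split=> [|w|w|w|w|w w'|w w'|w w' ww'|w]; apply: val_inj; apply/funext => x.
  - by rewrite /= !zx add_involutive.
  - by rewrite /= !ax add_involutive //; apply: L.
  - by rewrite /= !bx add_involutive.
  - by rewrite /= !ax !zx; apply: add_comm; [apply: T|apply: L].
  - by rewrite /= !bx !zx; apply: add_comm; [apply: T|apply: R].
  - by rewrite /= !ax; apply: add_comm; apply: L.
  - by rewrite /= !bx; apply: add_comm; apply: R.
  - by rewrite /= !ax !bx leaf_root_commute (negPf ww').
  - by rewrite /= !ax !bx !zx leaf_root_commute eqxx.
move=> x u hu tu; apply: contraTneq (tu) => z1.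
have := zE; rewrite z1 => /(congr1 (fun f => read t5 (f x) u)).
by rewrite /= /add read_flip // eqxx /= => /esym; case: (read _ _ _) (observe_all _ _ _ _) => -[].
Qed.

(** * Configurations that pass the test *)

Lemma exists_config (V : seq G) (s : G -> {ffun 'I_nb -> bool}) :
    {in V &, forall v w, v != w -> (2 * rad < nrm (v^-1 * w))%N} ->
  exists x : X, {in V, forall v,
    [/\ head x v, statics x v = s v & forall j, read j x v]}.
Proof.
move=> sep.
pose fill (t : {ffun 'I_nb -> bool}) (g : G) : A :=
  if (nrm g <= delta)%N then
    if [exists i, (g == static_cell i) && ~~ t i] then a0 else a1
  else if (nrm g <= delta.+2)%N || (g == p0) then a1 else a0.
(* Balls of radius [rad] around points of [V] are disjoint, so this list has at most one entry. *)
pose near c := [seq v <- V | (nrm (v^-1 * c) <= rad)%N].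
pose x : X := fun c => if near c is v :: _ then fill (s v) (v^-1 * c) else a0.
have xE v g : v \in V -> (nrm g <= rad)%N -> x (v * g) = fill (s v) g.
  move=> vV gr; rewrite /x; case nearE: (near _) => [|w l].
    have : v \in near (v * g) by rewrite mem_filter mulKg gr.
    by rewrite nearE.
  have : w \in near (v * g) by rewrite nearE mem_head.
  rewrite mem_filter => /andP[wg wV]; have [<-|vw] := eqVneq v w; first by rewrite mulKg.
  have vwE : g * (w^-1 * (v * g))^-1 = v^-1 * w.
    by rewrite !invgM invgK -!mulgA mulVKg.
  have := wnormM genS g (w^-1 * (v * g))^-1; rewrite vwE wnormV // => vw_le.
  have := leq_trans (sep v w vV wV vw) (leq_trans vw_le (leq_add gr wg)); lia.
have sj i : static_cell i \in wball S delta by rewrite mem_wball // static_cell_norm.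
exists x => v vV; split.
- apply/headP => g gr; rewrite xE // /cell_ok /fill.
  case: (nrm g <= delta)%N; last by case: (_ || _); rewrite eqxx.
  by rewrite /is_bit; case: ifP => _; rewrite eqxx ?orbT.
- apply/ffunP => i; rewrite ffunE xE //; last by have := static_cell_norm i; lia.
  rewrite /fill static_cell_norm; case: ifP.
    move=> /existsP[i' /andP[/eqP/cell_inj ii' ti']]; rewrite (negPf a01).
    have -> : i = i' by apply/val_inj/(@addnI 6)/ii'; rewrite ltn_add2l.
    by rewrite (negPf ti').
  rewrite eqxx => /negbT; rewrite negb_exists => /forallP/(_ i).
  by rewrite eqxx /= negbK => ->.
- move=> j; rewrite /read xE //; last by have := track_cell_norm j; lia.
  rewrite /fill track_cell_norm; case: ifP => //.
  by move=> /existsP[i /andP[ji _]]; rewrite (negPf (track_static_cell j i)) in ji.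
Qed.

(** If both children read one at time [k + 1], the added term vanishes and the value at time [k + 2]
    repeats that at time [k]. So ones persist for as many steps as there are levels below. *)
Lemma chi_levels (level : nat -> G -> Prop) x :
    (forall n u, level n u -> [/\ head x u, read t0 x u & read t1 x u]) ->
    (forall n u, level n.+1 u ->
      forall b, exists2 v, next (side b) x u = Some v & level n v) ->
  forall k n u, level n u -> (k <= n.+1)%N -> chi x k u.
Proof.
move=> lhead lnext k; elim/ltn_ind: k => -[|[|k]] IH n u lu kn.
- by have [] := lhead n u lu.
- by have [] := lhead n u lu.
have [hu _ _] := lhead n u lu; case: n lu kn => [//|n] lu kn.
rewrite chiSS // (IH k _ n.+1) //; try lia.
have a1b b : along (next (side b)) x (chi x k.+1) u.
  have [v nv lv] := lnext n u lu b; rewrite /along nv; apply: IH lv _; lia.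
by rewrite !a1b.
Qed.

Hypothesis decode : forall b (f : 'I_3 -> option I) p,
  exists s, [/\ br s = b, ch s =1 f & par s = p].

Section Embedding.
Context (V : seq G) (N : nat) (children : G -> seq G) (idx : G -> I).
Hypothesis sep : {in V &, forall v w, v != w -> (2 * rad < nrm (v^-1 * w))%N}.
Hypothesis V_norm : {in V, forall v, (nrm v <= N)%N}.
Hypothesis children_V : forall v c, c \in children v -> (v \in V) && (c \in V).
Hypothesis children_hop : forall v c, c \in children v -> c = v * hop (idx c).
Hypothesis children_norm : forall v c, c \in children v -> (nrm v < nrm c <= N)%N.

Local Notation branching := (branching children).
Local Notation selected := (selected children).

Lemma exists_tree_config :
  exists x (flag : G -> bool) (sel : G -> 'I_3 -> option G),
    {in V, forall v, [/\ head x v, br (statics x v) = flag v,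
      selected v (flag v) (sel v), forall j, read j x v &
      forall e c, sel v e = Some c -> down e x v = Some c]}.
Proof.
have /choice[sel selP] : forall v, exists ef : bool * ('I_3 -> option G),
    v \in V -> selected v ef.1 ef.2.
  move=> v; have [vV|_] := boolP (v \in V); last by exists (true, fun=> None).
  have [e [f ef]] := exists_selected children_norm (V_norm vV).
  by exists (e, f).
pose parent w := w * (hop (idx w))^-1.
(* The label found by [pick] is unique, as [selected] lets no child occupy two edges. *)
pose par_of w := if parent w \in V then
  omap (pair (idx w)) [pick e | (sel (parent w)).2 e == Some w] else None.
have /choice[s sP] : forall v, exists t, [/\ br t = (sel v).1,
    ch t =1 (fun e => omap idx ((sel v).2 e)) & par t = par_of v].
  by move=> v; apply: decode.
have [x xP] := exists_config s sep.
exists x, (fun v => (sel v).1), (fun v => (sel v).2) => v vV.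
have [hv sv rv] := xP v vV; split=> //.
- by rewrite sv; have [] := sP v.
- exact: selP.
move=> e c sc; have [selc selinj _ _] := selP v vV.
have cv := selc _ _ sc; have /andP[_ cV] := children_V cv.
have [hc stc _] := xP c cV; have cE := children_hop cv.
rewrite /down sv; have [_ -> _] := sP v; rewrite sc /= -cE hc stc.
have [_ _ ->] := sP c; rewrite /par_of.
have -> : parent c = v by rewrite /parent {1}cE mulgK.
rewrite vV; case: pickP => [e' /eqP sc'|/(_ e)]; last by rewrite sc eqxx.
by rewrite /= (selinj _ _ _ sc' sc) eqxx.
Qed.

(** The rank of branching serves as the level: from a binary node of rank [n + 1], either edge leads
    through unary nodes to a binary node of rank [n]. *)
Lemma exists_test_config J v : v \in V -> (N <= 2 ^ K)%N ->
    branching (2 ^ J).*2 v ->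
  exists (x : X) u, head x u /\ observe_all J 0 x u.
Proof.
move=> vV NK bv; have [x [flag [sel xP]]] := exists_tree_config.
pose level n u := [/\ u \in V, flag u & branching n u].
have walk n w : w \in V -> branching n w -> exists u i, [/\ level n u,
    (i + nrm w <= N)%N & iter i (obind (down_unary x)) (Some w) = Some u].
  (* The walk ends because norms increase along edges and stay at most [N], which also bounds its
     number of steps. *)
  move: {2}(N - nrm w).+1 (ltnSn (N - nrm w)) => m.
  elim: m w => [//|m IH] w lt_m wV bw.
  have [hw brw selw _ downw] := xP w wV.
  case fw: (flag w) in selw; first by exists w, 0%N; split=> //; apply: V_norm.
  have [selc _ /(_ erefl)[c sc cb] _] := selw.
  have cw := selc _ _ sc; have /andP[_ cV] := children_V cw.
  have /andP[wc cN] := children_norm cw.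
  have [|u [i [lu iN iE]]] := IH c _ cV (cb _ bw); first lia.
  exists u, i.+1; split=> //; first lia.
  by rewrite iterSr /= /down_unary brw fw (downw _ _ sc).
have level_next n u : level n.+1 u -> forall b,
    exists2 u', next (side b) x u = Some u' & level n u'.
  move=> [uV fu bu] b; have [hu _ + _ downu] := xP u uV.
  rewrite fu => -[selc _ _ /(_ erefl)/(_ (side b) n)].
  have sb : side b != ord0 by case: (b).
  move=> /(_ sb bu)[c sc bc]; have cu := selc _ _ sc.
  have /andP[_ cV] := children_V cu.
  have [u' [i [lu' iN iE]]] := walk n c cV bc; exists u' => //.
  rewrite /next /pcomp (downu _ _ sc) /= psquareE.
  have iK : (i <= 2 ^ K)%N by lia.
  rewrite -(subnK iK) iterD iE; have [u'V fu' _] := lu'.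
  have [_ bru' _ _ _] := xP u' u'V.
  by elim: (2 ^ K - i)%N => //= k ->; rewrite /= /down_unary bru' fu'.
have [u [_ [lu _ _]]] := walk _ v vV bv; exists x, u.
have level_head n w : level n w -> [/\ head x w, read t0 x w & read t1 x w].
  by move=> [wV _ _]; have [hw _ _ rw _] := xP w wV.
split; first by have [] := level_head _ _ lu.
by apply/observe_allP => k kJ; apply: chi_levels lu _ => //; lia.
Qed.
End Embedding.
End Heads.

(** * Choice of the parameters *)

Lemma exists_decoder (I : finType) (nb : nat) :
    (2 * #|I|.+1 ^ 3 * (#|I| * 3).+1 <= 2 ^ nb)%N ->
  exists (br : {ffun 'I_nb -> bool} -> bool)
         (ch : {ffun 'I_nb -> bool} -> 'I_3 -> option I)
         (par : {ffun 'I_nb -> bool} -> option (I * 'I_3)),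
    forall b f p, exists s, [/\ br s = b, ch s =1 f & par s = p].
Proof.
pose symbol := (bool * {ffun 'I_3 -> option I} * option (I * 'I_3))%type.
move=> le_nb; have card_symbol : (#|{: symbol}| <= #|{ffun 'I_nb -> bool}|)%N.
  rewrite card_ffun card_bool card_ord !card_prod card_bool card_ffun !card_option.
  by rewrite card_prod !card_ord.
pose s0 : symbol := (true, [ffun=> None], None).
(* Codes beyond the number of symbols decode to [s0]. *)
pose dec (t : {ffun 'I_nb -> bool}) : symbol := nth s0 (enum {: symbol}) (enum_rank t).
exists (fun t => (dec t).1.1), (fun t => (dec t).1.2), (fun t => (dec t).2) => b f p.
pose s : symbol := (b, finfun f, p).
have lt_s : (enum_rank s < #|{ffun 'I_nb -> bool}|)%N.
  exact: leq_trans (ltn_ord _) card_symbol.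
exists (enum_val (Ordinal lt_s)).
have -> : dec (enum_val (Ordinal lt_s)) = s.
  by rewrite /dec enum_valK /= nth_enum_rank.
by split=> // e; rewrite ffunE.
Qed.

Section GrowthBounds.
Context (G : groupType) (S : set G).
Hypothesis genS : generated S = [set: G].
Hypothesis finS : finite_set S.
Context (d0 m0 : nat).
Hypothesis growth : forall m, (m0 <= m)%N ->
  (2 ^ (m ^ 2) <= size (wball S (m ^ d0)))%N.

Lemma growth_unbounded k : exists m, (k < size (wball S m))%N.
Proof.
exists ((m0 + k.+1) ^ d0)%N; apply: leq_trans (growth (leq_addr _ _)).
apply: leq_trans (ltn_expl k (isT : 1 < 2)%N) _; rewrite leq_exp2l //.
by rewrite -[X in (X <= _)%N]expn1; nia.
Qed.

(** The number of hops is at most exponential in [delta], so naming them takes a number of bits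
    linear in [delta]. For [delta = m ^ d0] the ball of radius [delta] offers [2 ^ (m ^ 2)] cells,
    which is more. *)
Lemma exists_parameters : exists delta p0 nb,
  [/\ wnorm S p0 = (3 * delta + 7)%N, (6 + nb <= size (wball S delta))%N &
    let n := size (wball S (2 * (2 * (5 * delta + 11)) + 1)) in
    (2 * n.+1 ^ 3 * (n * 3).+1 <= 2 ^ nb)%N].
Proof.
pose b := size (wball S 1).
have b_gt0 : (0 < b)%N by apply: wball_gt0.
(* The constant comes from [20 * delta + 45 <= 65 * delta], valid once [delta] is positive. *)
have [m1 m1P] := leq_poly_exp d0 (6 + 12 * b * 65).
pose m := (maxn m0 m1).+1; pose delta := (m ^ d0)%N.
have delta_gt0 : (0 < delta)%N by rewrite expn_gt0.
have [p0 p0E] := exists_wnorm genS finS (3 * delta + 7) growth_unbounded.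
exists delta, p0, (12 * b * (20 * delta + 45))%N; split=> //.
  have m0m : (m0 <= m)%N by rewrite /m; lia.
  have m1m : (m1 <= m)%N by rewrite /m; lia.
  apply: leq_trans (growth m0m).
  apply: (@leq_trans (2 ^ m)); last by rewrite leq_exp2l // /m; nia.
  apply: leq_trans (m1P m m1m); rewrite -/delta; nia.
move=> n; set e := (20 * delta + 45)%N.
have n_gt0 : (0 < n)%N by apply: wball_gt0.
have n_le : (n.+1 <= (2 * b) ^ e)%N.
  have : (n <= b ^ e)%N.
    have -> : e = (2 * (2 * (5 * delta + 11)) + 1)%N by rewrite /e; lia.
    exact: leq_wball_exp.
  rewrite expnMn; have : (2 <= 2 ^ e)%N by rewrite -[X in (X <= _)%N]expn1 leq_exp2l // /e; lia.
  by move=> h1 h2; nia.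
apply: (@leq_trans (n.+1 ^ 6)).
  have -> : (n.+1 ^ 6 = n.+1 * n.+1 ^ 3 * n.+1 ^ 2)%N by rewrite -expnS -expnD.
  by apply: leq_mul; [rewrite leq_mul2r; lia|rewrite expnS expn1; nia].
apply: (@leq_trans (((2 * b) ^ e) ^ 6)); first by rewrite leq_exp2r.
have -> : (12 * b * e = 2 * b * (e * 6))%N by nia.
rewrite -(expnM (2 * b)) (expnM 2 (2 * b)) leq_exp2r; last by rewrite muln_gt0 /e addnS.
exact/ltnW/ltn_expl.
Qed.

(** The left side is the bound of [size_descendants] for a tree of height [k ^ d0] without branching
    of rank [k], times the size [W] of a ball. It is at most the [k]-th power of a polynomial in
    [k], hence below [2 ^ (k ^ 2)]. *)
Lemma growth_beats_branching (D W : nat) : (0 < W)%N ->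
  exists J0, forall J k, (J0 <= J)%N -> k = (2 ^ J.+1)%N ->
    (D.+1 ^ k.-1 * (k ^ d0).+1 ^ k * W < size (wball S (k ^ d0)))%N.
Proof.
move=> W_gt0; have [m1 m1P] := leq_poly_exp d0 (2 * D.+1 * W).+1.
exists (maxn m0 m1) => J k + kE; rewrite geq_max => /andP[J0 J1].
have Jk : (J < k)%N.
  by rewrite kE; apply: leq_trans (ltn_expl J (isT : 1 < 2)%N) _; rewrite leq_exp2l.
have k0 : (m0 <= k)%N by lia.
have k1 : (m1 <= k)%N by lia.
have k_gt0 : (0 < k)%N by lia.
apply: leq_trans (growth k0); rewrite -mulnn expnM.
apply: (@leq_ltn_trans ((D.+1 * (k ^ d0).+1 * W) ^ k)).
  rewrite !expnMn; apply: leq_mul.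
    by rewrite leq_mul2r leq_pexp2l ?leq_pred ?orbT.
  by rewrite -[X in (X <= _)%N]expn1 leq_pexp2l.
rewrite ltn_exp2r //; apply: leq_trans (m1P k k1).
have : (0 < k ^ d0)%N by rewrite expn_gt0 k_gt0.
nia.
Qed.
End GrowthBounds.

Lemma leq_cost J d :
  (10 ^ J * (1 + 4 * 2 ^ J * (17 + 12 * 4 ^ (J.+1 * d))) <=
   2 ^ ((5 + 2 * d) * J + (7 + 2 * d)))%N.
Proof.
have -> : ((5 + 2 * d) * J + (7 + 2 * d) = 4 * J + (7 + J + 2 * (J.+1 * d)))%N by nia.
rewrite 2!expnD (expnM 2 4) (expnD 2 7) (expnM 2 2).
set x := (4 ^ _)%N; set y := (2 ^ J)%N.
have x_gt0 : (0 < x)%N by rewrite expn_gt0.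
have y_gt0 : (0 < y)%N by rewrite expn_gt0.
apply: leq_mul; first by case: (J) => // j; rewrite leq_exp2r.
rewrite -/x (_ : 2 ^ 7 = 128)%N //; nia.
Qed.

(** Put [M = 2 ^ J]. The radius of [f z] is polynomial in [M], so the torus bound, after taking
    logarithms, puts [2 ^ M.-1] below a polynomial in [M]. *)
Lemma no_embedding (K : groupType) (T : set K) (e0 e1 : nat) (B : finType) (d : nat) :
    finite_set T ->
    (exists J0, forall J, (J0 <= J)%N ->
      exists (z : K) (a b : (2 ^ J).-1.-tuple bool -> K) n,
      [/\ heisenberg_family z a b,
        (n <= 2 ^ (e1 * J + e0))%N /\ word_length T n z, z != 1,
        forall w, generated T (a w) & forall w, generated T (b w)]) ->
  ~ embeds (generated T) (shift_aut (Zpow d) B).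
Proof.
move=> fin_gens [J0 familyP] [f [fM f_inj]].
have [r rP] : exists r, forall g, T g -> has_radius r (f g).
  have /choice[rad radP] : forall g, exists n, has_radius n (f g).
    by move=> g; apply: exists_radius.
  have [s sE] : exists s : seq K, T = [set` s].
    exact/finite_seqP.
  exists (\max_(g <- s) rad g)%N => g; rewrite sE /= => gs.
  by apply: has_radius_leq (radP g); apply: leq_bigmax_seq.
pose c1 := (2 * r.+1 * 2 ^ e0 + 1)%N.
have [m1 m1P] := leq_poly_exp (e1 * d) (2 * #|B| * c1 ^ d).+1.
pose J := maxn J0 m1; pose M := (2 ^ J)%N.
have [z [a [b [n [hf [n_le zl] z1 aH bH]]]]] := familyP J (leq_maxl _ _).
have zH : generated T z := word_length_generated zl.
have hf' := heisenberg_family_morph (is_subgroup_generated T) fM zH aH bH hf.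
have fz1 : f z != 1.
  have [H1 _] := is_subgroup_generated T.
  apply: contraNneq z1 => fz1; apply/eqP.
  apply: f_inj; rewrite ?in_setE // fz1.
  apply: (mulgI (f 1)); rewrite -fM ?in_setE // mulg1.
  by rewrite mulg1.
have rad_z := has_radius_word_length fM rP zl.
have := heisenberg_family_bound (enum_uniq {: M.-1.-tuple bool}) rad_z fz1 hf'.
rewrite -cardE card_tuple card_bool.
set L := (n * r)%N => bound.
have M_gt0 : (0 < M)%N by rewrite expn_gt0.
have JM : (m1 <= M)%N.
  by apply: leq_trans (leq_maxr J0 m1) _; apply/ltnW/ltn_expl.
have LE : (L.*2.+1 <= c1 * M ^ e1)%N.
  have : (L <= 2 ^ (e1 * J + e0) * r)%N by rewrite leq_mul2r n_le orbT.
  rewrite expnD (mulnC e1) expnM -/M /c1.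
  have : (0 < M ^ e1)%N by rewrite expn_gt0 M_gt0.
  move: (M ^ e1)%N (2 ^ e0)%N => x y; nia.
have {}bound : (2 ^ M.-1 <= #|B| * L.*2.+1 ^ d)%N.
  rewrite -(leq_exp2l _ _ (isT : 1 < 2)%N); apply: leq_trans bound _.
  by rewrite expnM leq_exp2r ?expn_gt0 //; apply/ltnW/ltn_expl.
have := m1P M JM; apply/negP; rewrite -ltnNge.
have -> : (2 ^ M = 2 * 2 ^ M.-1)%N by rewrite -expnS prednK.
apply: (@leq_ltn_trans (2 * (#|B| * (c1 * M ^ e1) ^ d))).
  rewrite leq_mul2l /=; apply: leq_trans bound _; rewrite leq_mul2l.
  by apply/orP; right; case: (d) => // d'; rewrite leq_exp2r.
rewrite expnMn -expnM mulSn !mulnA.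
have : (0 < M ^ (e1 * d))%N by rewrite expn_gt0 M_gt0.
lia.
Qed.

Theorem theorem8 (R : realType) (G : groupType) (A : finType)
    (fgG : @fin_gen G [set: G]%classic)
    (growthG : stretched_exp_growth R G)
    (cardA : (2 <= #|A|)%N) :
  exists H : set (shift_aut G A),
    [/\ is_subgroup H,
        fin_gen H
      & forall (B : finType) (d : nat), ~ embeds H (shift_aut (Zpow d) B)].
Proof.
have [S [finS genS [d0 [m0 growth]]]] := ball_growth growthG.
have [a0 [a1 a01]] : exists a0 a1 : A, a0 != a1.
  have /card_gt1P[a0 [a1 [_ _ a01]]] := cardA.
  by exists a0, a1.
have [delta [p0 [nb [p0E cells symbols]]]] := exists_parameters genS finS growth.
(* Net points at distance above twice the radius of a head carry disjoint heads. *)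
pose r := (2 * (5 * delta + 11))%N; pose W := size (wball S r).
pose D := size (wball S (2 * r + 1)).
have [|br [ch [par decode]]] := @exists_decoder 'I_D nb; first by rewrite card_ord.
(* This finite set is fixed before [J]: the same gates serve trees of every depth. *)
pose T := @gates G A S a0 a1 delta p0 nb _ (@net_hop G S r).
have finT : finite_set T by apply: finite_gates.
exists (generated T); split; [exact: is_subgroup_generated|by exists T|].
move=> B d; apply: (@no_embedding _ _ (7 + 2 * d0) (5 + 2 * d0)) => //.
have W_gt0 : (0 < W)%N by apply: wball_gt0.
have [J0 J0P] := growth_beats_branching growth D W_gt0.
exists J0 => J leJ; pose k := (2 ^ J.+1)%N; pose N := (k ^ d0)%N.
(* Chosen so that [2 ^ K = N], which bounds the length of every subdivided edge. *)
pose K := (J.+1 * d0)%N.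
have [z [a [b [n [hf [n_le zl] aH bH z_neq]]]]] :=
  exists_heisenberg_family genS finS a01 p0E cells (@net_hop G S r) br ch par K J.
exists z, a, b, n; split=> //.
  by split=> //; apply: leq_trans n_le (leq_cost J d0).
have [V [children [idx [[V1 sep V_norm] [chV chhop chnorm] [chuniq chsize] count]]]] :=
  exists_net_tree genS finS r N.
(* Otherwise the net tree would have too few nodes for its balls of radius [r] to cover the ball of
   radius [N]. *)
have rank1 : branching children (2 ^ J).*2 1.
  apply: contrapT => nb1; have := J0P J k leJ erefl; apply/negP; rewrite -leqNgt.
  have kE : (2 ^ J).*2 = k.-1.+1 by rewrite /k prednK ?expn_gt0 // expnS mul2n.
  rewrite kE in nb1; apply: leq_trans (count N (leqnn _)) _.
  rewrite leq_mul2r; apply/orP; right.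
  have := size_descendants chuniq chsize N nb1.
  by rewrite prednK ?expn_gt0.
have [|x [u [hu tu]]] := exists_test_config genS finS a01 p0E cells decode sep V_norm
  chV chhop chnorm V1 _ rank1 (K := K).
  by rewrite /N /k /K expnM.
exact: z_neq hu tu.
Qed.
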